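(* Let $G$ be a Lie group and $(\pi:E_G\to X_0,\mu,\mathbb{X})$ a quasi-principal $G$-bundle over a Lie groupoid $\mathbb{X}$. Let $(G,H,\tau,\alpha)$ be a Lie crossed module together with smooth maps $\mathcal{H}_u:E_G\to H$ and $\mathcal{H}_m:X_1\times_{s,X_0,t}X_1\to H$ satisfying the coherence properties (a)-(k) listed in the context. Then: (1) The manifolds $(s^*E_G)^{\mathrm{q\text{-}dec}}:=s^*E_G\times H$ and $E_G$ define a Lie groupoid $[(s^*E_G)^{\mathrm{q\text{-}dec}}\rightrightarrows E_G]$ with structure maps: (i) source $(\gamma,p,h)\mapsto p$; (ii) target $(\gamma,p,h)\mapsto\mu(\gamma,p)\tau(h^{-1})$; (iii) composition $\big((\gamma_2,p_2,h_2),(\gamma_1,p_1,h_1)\big)\mapsto\big(\gamma_2\circ\gamma_1,p_1,h_2h_1\mathcal{H}_m^{-1}(\gamma_2,\gamma_1)\big)$; (iv) unit $p\mapsto(1_{\pi(p)},p,\mathcal{H}_u(p))$; (v) inverse $(\gamma,p,h)\mapsto\big(\gamma^{-1},\mu(\gamma,p)\tau(h^{-1}),\mathcal{H}_u(p)\mathcal{H}_m(\gamma^{-1},\gamma)h^{-1}\big)$. (2) The Lie groupoid $\mathbb{E}^{\mathrm{q\text{-}dec}}:=[(s^*E_G)^{\mathrm{q\text{-}dec}}\rightrightarrows E_G]$ forms a quasi-principal $[H\rtimes_\alpha G\rightrightarrows G]$-bundle $\pi^{\mathrm{q\text{-}dec}}:\mathbb{E}^{\mathrm{q\text{-}dec}}\to\mathbb{X}$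 over $\mathbb{X}$, equipped with the quasi connection $\mathcal{C}^{\mathrm{q\text{-}dec}}:s^*E_G\to(s^*E_G)^{\mathrm{q\text{-}dec}}$, $(\gamma,p)\mapsto(\gamma,p,e)$. Here the right action of $[H\rtimes_\alpha G\rightrightarrows G]$ is $(p,g)\mapsto pg$ on objects and $\big((\gamma,p,h),(h',g)\big)\mapsto\big(\gamma,pg,\alpha_{g^{-1}}(h'^{-1}h)\big)$ on morphisms, and the bundle projection is $p\mapsto\pi(p)$, $(\gamma,p,h)\mapsto\gamma$. (3) The quasi connection $\mathcal{C}^{\mathrm{q\text{-}dec}}$ is a categorical connection if and only if the maps $\mathcal{H}_u$ and $\mathcal{H}_m$ are constant maps to $e$.
   Context: In a Lie groupoid $\mathbb{X}=[X_1\rightrightarrows X_0]$ the source and target are $s,t$, the unit is $x\mapsto 1_x$, and $\gamma_2\circ\gamma_1$ is defined when $t(\gamma_1)=s(\gamma_2)$. $X_1\times_{s,X_0,t}X_1$ is the set of pairs $(\gamma_2,\gamma_1)$ with $s(\gamma_2)=t(\gamma_1)$. Morphisms of Lie groupoids are smooth functors. A Lie crossed module $(G,H,\tau,\alpha)$ consists of Lie groups $G,H$, a homomorphism $\tau:H\to G$ and a smooth action $\alpha$ of $G$ on $H$ by automorphisms $\alpha_g$, with $\tau(\alpha(g,h))=g\tau(h)g^{-1}$ and $\alpha(\tau(h),h')=hh'h^{-1}$. Its Lie 2-group is $[H\rtimes_\alpha G\rightrightarrows G]$ with $s(h,g)=g$, $t(h,g)=\tau(h)g$, $(h_2,g_2)\circ(h_1,g_1)=(h_2h_1,g_1)$,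 $1_g=(e,g)$, and group product $(h_2,g_2)(h_1,g_1)=(h_2\alpha(g_2,h_1),g_2g_1)$. A quasi-principal $G$-bundle $(\pi:E_G\to X_0,\mu,\mathbb{X})$ is a principal $G$-bundle $\pi:E_G\to X_0$ with a smooth map $\mu:s^*E_G=X_1\times_{s,X_0,\pi}E_G\to E_G$ such that $\pi(\mu(\gamma,p))=t(\gamma)$ and $\mu(\gamma,pg)=\mu(\gamma,p)g$. Coherence properties (for all elements for which the expressions make sense; $\mathcal{H}_m^{-1}(\cdot)$ is the inverse element in $H$): (a) $\mu(1_{\pi(p)},p)=p\,\tau(\mathcal{H}_u(p))$; (b) $\mu(\gamma_2,\mu(\gamma_1,p))=\mu(\gamma_2\circ\gamma_1,p)\,\tau(\mathcal{H}_m(\gamma_2,\gamma_1))$; (c) $\mathcal{H}_m(\gamma,1_{\pi(p)})=\mathcal{H}_u(p)$ when $s(\gamma)=\pi(p)$; (d) $\mathcal{H}_m(1_{\pi(\mu(\gamma,p))},\gamma)=\mathcal{H}_u(\mu(\gamma,p))$; (e) $\mathcal{H}_u$ is $G$-invariant; (f) $\alpha_{g^{-1}}(\mathcal{H}_u(p))=\mathcal{H}_u(p)$ for all $g\in G$; (g) $\mathcal{H}_u(p)\in Z(H)$, the centre of $H$; (h) $\alpha_{g^{-1}}(\mathcal{H}_m^{-1}(\gamma_2,\gamma_1))=\mathcal{H}_m^{-1}(\gamma_2,\gamma_1)$ for all $g\in G$; (i) $\mathcal{H}_m(\gamma_2,\gamma_1)\in Z(H)$; (j) $\mathcal{H}_m^{-1}(\gamma_3,\gamma_2)\mathcal{H}_m^{-1}(\gamma_3\circ\gamma_2,\gamma_1)=\mathcal{H}_m^{-1}(\gamma_2,\gamma_1)\mathcal{H}_m^{-1}(\gamma_3,\gamma_2\circ\gamma_1)$;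 (k) $\mathcal{H}_m(\gamma^{-1},\gamma)\mathcal{H}_m(\gamma,\gamma^{-1})^{-1}=\mathcal{H}_u(p)^{-1}\mathcal{H}_u(\mu(\gamma,p))$ for $(\gamma,p)\in s^*E_G$. For a Lie 2-group $\mathbb{G}=[G_1\rightrightarrows G_0]$, a principal $\mathbb{G}$-bundle over $\mathbb{X}$ is a morphism of Lie groupoids $\pi:\mathbb{E}=[E_1\rightrightarrows E_0]\to\mathbb{X}$ with a right action of $\mathbb{G}$ on $\mathbb{E}$ (a smooth functor $\mathbb{E}\times\mathbb{G}\to\mathbb{E}$, a Lie group action on objects and on morphisms) such that $\pi_0$ and $\pi_1$ are principal $G_0$- and $G_1$-bundles. A quasi connection is a smooth map $\mathcal{C}:s^*E_0=X_1\times_{s,X_0,\pi_0}E_0\to E_1$ with $s(\mathcal{C}(\gamma,p))=p$, $\pi_1(\mathcal{C}(\gamma,p))=\gamma$ and $\mathcal{C}(\gamma,pg)=\mathcal{C}(\gamma,p)1_g$; $(\pi,\mathcal{C})$ is then a quasi-principal $\mathbb{G}$-bundle. $\mathcal{C}$ is a categorical connection if moreover $\mathcal{C}(1_x,p)=1_p$ for $p\in\pi_0^{-1}(x)$, and $\mathcal{C}(\gamma_2\circ\gamma_1,p_1)=\mathcal{C}(\gamma_2,p_2)\circ\mathcal{C}(\gamma_1,p_1)$ whenever $s(\gamma_2)=t(\gamma_1)$ and $p_2=t(\mathcal{C}(\gamma_1,p_1))$. *)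

(* Defs.v *)
From HB Require Import structures.
From mathcomp Require Import all_boot all_order all_algebra.
From mathcomp Require Import all_classical all_reals all_analysis.
Import numFieldNormedType.Exports.

Set Implicit Arguments.
Unset Strict Implicit.
Unset Printing Implicit Defensive.

Local Open Scope classical_set_scope.
Local Open Scope ring_scope.

(* Smooth manifolds.  A [chartedType] is a topological space with a set of    *)
(* charts and no axioms, so that products and subsets are charted types       *)
(* unconditionally; [manifold] states the axioms.  Charts are total functions *)
(* of which only the values on [cdom] matter.                                 *)

Section Euclidean.
Context {R : realType} {n m : nat}.

Fixpoint Ck (k : nat) (U : set 'rV[R]_n) (g : 'rV[R]_n -> 'rV[R]_m) : Prop :=
  if k is k'.+1 then
    (forall x, U x -> differentiable g x) /\
    (forall v, Ck k' U (fun x => 'D_v g x))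
  else forall x, U x -> {for x, continuous g}.

Definition smooth_near (g : 'rV[R]_n -> 'rV[R]_m) (a : 'rV[R]_n) : Prop :=
  exists U : set 'rV[R]_n, [/\ open U, U a & forall k, Ck k U g].

End Euclidean.

Record chart (R : realType) (X : Type) := Chart {
  cdim : nat;
  cdom : set X;
  cmap : X -> 'rV[R]_cdim
}.

HB.mixin Record hasAtlas (R : realType) M & Topological M := {
  atlas : set (chart R M)
}.

#[short(type="chartedType")]
HB.structure Definition Charted (R : realType) :=
  {M of Topological M & hasAtlas R M}.

Section Charts.
Context {R : realType}.

(* The last clause with V = cdom c says that cmap c has open image; together the *)
(* clauses say that cmap c is a homeomorphism from cdom c onto an open set.   *)
Definition is_chart (X : topologicalType) (c : chart R X) : Prop :=
  [/\ open (cdom c),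
      {in cdom c &, injective (cmap c)},
      forall x, cdom c x -> {for x, continuous (cmap c)} &
      forall V : set X, open V -> V `<=` cdom c -> open (cmap c @` V)].

(* g is a smooth local representative of f at x: cmap d \o f = g \o cmap c    *)
(* near x.  As cmap c has open image, g is determined near cmap c x.          *)
Definition local_rep (X Y : topologicalType) (c : chart R X) (d : chart R Y)
    (f : X -> Y) (x : X) (g : 'rV[R]_(cdim c) -> 'rV[R]_(cdim d)) : Prop :=
  [/\ cdom c x, cdom d (f x), smooth_near g (cmap c x) &
      \forall y \near x, cdom d (f y) /\ cmap d (f y) = g (cmap c y)].
Arguments local_rep {X Y} c d f x g.

Definition compatible (X : topologicalType) (c d : chart R X) : Prop :=
  forall x, cdom c x -> cdom d x ->
    (exists g, local_rep c d id x g) /\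
    (exists g, local_rep d c id x g).

Record manifold (M : chartedType R) : Prop := {
  manifold_hausdorff : hausdorff_space M;
  manifold_countable : @second_countable M;
  manifold_cover : forall x : M, exists2 c, (atlas : set (chart R M)) c & cdom c x;
  manifold_chart : forall c : chart R M, atlas c -> is_chart c;
  manifold_compat : forall c d : chart R M, atlas c -> atlas d -> compatible c d;
  manifold_dim : exists n : nat,
    forall c : chart R M, atlas c -> cdom c !=set0 -> cdim c = n
}.

Definition smooth_at (M N : chartedType R) (f : M -> N) (x : M) : Prop :=
  exists c d g, [/\ atlas c, atlas d & local_rep c d f x g].

Definition smooth (M N : chartedType R) (f : M -> N) : Prop :=
  forall x, smooth_at f x.

Definition submersion (M N : chartedType R) (f : M -> N) : Prop :=
  forall x, exists c d g,
    [/\ atlas c, atlas d, local_rep c d f x g &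
        forall w, exists v, 'd g (cmap c x) v = w].

Definition prod_chart (X Y : Type) (c : chart R X) (d : chart R Y) :
    chart R (X * Y) :=
  @Chart R _ (cdim c + cdim d) (cdom c `*` cdom d)
    (fun x => row_mx (cmap c x.1) (cmap d x.2)).

Definition prod_atlas (M N : chartedType R) : set (chart R (M * N)) :=
  [set e | exists c d, [/\ atlas c, atlas d & e = prod_chart c d]].

HB.instance Definition _ (M N : chartedType R) :=
  hasAtlas.Build R (M * N)%type (@prod_atlas M N).

(* The charts of the embedded submanifold A of M are the restrictions to A of *)
(* the slice charts, i.e. of the charts of the maximal atlas of M in which A  *)
(* is the zero set of the last l coordinates.  A is an embedded submanifold   *)
(* exactly if the domains of these charts cover A.                            *)
Definition slice_atlas (M : chartedType R) (A : set M) :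
    set (chart R (set_type A)) :=
  [set e | exists k l (U : set M) (phi : M -> 'rV[R]_(k + l)),
    let c := Chart U phi in
    [/\ is_chart c,
        forall d, atlas d -> compatible c d,
        forall x, U x -> (A x <-> rsubmx (phi x) = 0) &
        e = Chart (fun x : set_type A => U (val x))
                  (fun x => lsubmx (phi (val x)))]].

HB.instance Definition _ (M : chartedType R) (A : set M) :=
  hasAtlas.Build R (set_type A) (@slice_atlas M A).

End Charts.

(* The fibre product of f : M -> Z and g : N -> Z, with the embedded          *)
(* submanifold structure in M * N.                                            *)
Section FibreProduct.
Context {R : realType} {M N : chartedType R} {Z : Type}.
Variables (f : M -> Z) (g : N -> Z).

Definition fibprod : chartedType R :=
  set_type [set x : M * N | f x.1 = g x.2].

Definition fpair (x : M) (y : N) (e : f x = g y) : fibprod :=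
  exist _ (x, y) (@mem_set _ [set z : M * N | f z.1 = g z.2] (x, y) e).

Definition fp1 (u : fibprod) : M := (val u).1.
Definition fp2 (u : fibprod) : N := (val u).2.

Lemma fpE (u : fibprod) : f (fp1 u) = g (fp2 u).
Proof. exact: set_mem (valP u). Qed.

End FibreProduct.
Arguments fpair {R M N Z f g} x y e.
Arguments fp1 {R M N Z f g} u.
Arguments fp2 {R M N Z f g} u.

#[short(type="chartedGroupType")]
HB.structure Definition ChartedGroup (R : realType) :=
  {G of Group G & Charted R G}.

Section LieGroups.
Context {R : realType}.

Record lie_group (G : chartedGroupType R) : Prop := {
  lie_group_manifold : manifold G;
  lie_group_mul : smooth (fun x : G * G => (x.1 * x.2)%g);
  lie_group_inv : smooth (fun x : G => (x^-1)%g)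
}.

Definition right_action (P : Type) (G : groupType) (a : P * G -> P) : Prop :=
  (forall p, a (p, 1%g) = p) /\
  (forall p g g', a (a (p, g), g') = a (p, (g * g')%g)).

(* Phi and Psi are mutually inverse on pi^-1(U) and U * G; their values       *)
(* elsewhere are irrelevant.                                                  *)
Definition local_trivialization (P M : chartedType R) (G : chartedGroupType R)
    (pi : P -> M) (a : P * G -> P) (U : set M)
    (Phi : P -> M * G) (Psi : M * G -> P) : Prop :=
  [/\ forall p, U (pi p) ->
        [/\ smooth_at Phi p, (Phi p).1 = pi p & Psi (Phi p) = p],
      forall x g, U x ->
        [/\ smooth_at Psi (x, g), pi (Psi (x, g)) = x &
            Phi (Psi (x, g)) = (x, g)] &
      forall p g, U (pi p) -> Phi (a (p, g)) = ((Phi p).1, ((Phi p).2 * g)%g)].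

Record principal_bundle (P M : chartedType R) (G : chartedGroupType R)
    (pi : P -> M) (a : P * G -> P) : Prop := {
  pb_group : lie_group G;
  pb_total : manifold P;
  pb_base : manifold M;
  pb_proj_smooth : smooth pi;
  pb_act_smooth : smooth a;
  pb_action : right_action a;
  pb_fibre : forall p g, pi (a (p, g)) = pi p;
  pb_trivial : forall x : M, exists U Phi Psi,
    [/\ open U, U x & local_trivialization pi a U Phi Psi]
}.

End LieGroups.

Record groupoid (R : realType) := Groupoid {
  obj : chartedType R;
  mor : chartedType R;
  src : mor -> obj;
  tgt : mor -> obj;
  gcomp_fp : fibprod src tgt -> mor;
  gunit : obj -> mor;
  ginv : mor -> mor
}.
Arguments src {R g} _.
Arguments tgt {R g} _.
Arguments gcomp_fp {R g} _.
Arguments gunit {R g} _.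
Arguments ginv {R g} _.

(* g2 \o g1, with e : src g2 = tgt g1 *)
Definition gcomp (R : realType) (X : groupoid R) (g2 g1 : mor X)
  (e : src g2 = tgt g1) : mor X := gcomp_fp (fpair g2 g1 e).
Arguments gcomp {R X} g2 g1 e.

Section LieGroupoids.
Context {R : realType}.

Record lie_groupoid (X : groupoid R) : Prop := {
  lg_obj : manifold (obj X);
  lg_mor : manifold (mor X);
  lg_src_smooth : smooth (@src R X);
  lg_tgt_smooth : smooth (@tgt R X);
  lg_src_subm : submersion (@src R X);
  lg_tgt_subm : submersion (@tgt R X);
  lg_src_surj : set_surj [set: mor X] [set: obj X] (@src R X);
  lg_tgt_surj : set_surj [set: mor X] [set: obj X] (@tgt R X);
  lg_comp_smooth : smooth (@gcomp_fp R X);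
  lg_unit_smooth : smooth (@gunit R X);
  lg_inv_smooth : smooth (@ginv R X);
  lg_src_comp : forall (b a : mor X) e, src (gcomp b a e) = src a;
  lg_tgt_comp : forall (b a : mor X) e, tgt (gcomp b a e) = tgt b;
  lg_src_unit : forall x : obj X, src (gunit x) = x;
  lg_tgt_unit : forall x : obj X, tgt (gunit x) = x;
  lg_src_inv : forall a : mor X, src (ginv a) = tgt a;
  lg_tgt_inv : forall a : mor X, tgt (ginv a) = src a;
  lg_compA : forall (c b a : mor X) ecb eba e e',
    gcomp c (gcomp b a eba) e = gcomp (gcomp c b ecb) a e';
  lg_comp1l : forall (a : mor X) e, gcomp (gunit (tgt a)) a e = a;
  lg_comp1r : forall (a : mor X) e, gcomp a (gunit (src a)) e = a;
  lg_compVl : forall (a : mor X) e, gcomp (ginv a) a e = gunit (src a);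
  lg_compVr : forall (a : mor X) e, gcomp a (ginv a) e = gunit (tgt a)
}.

Record lie_functor (X Y : groupoid R)
    (f0 : obj X -> obj Y) (f1 : mor X -> mor Y) : Prop := {
  lf_obj_smooth : smooth f0;
  lf_mor_smooth : smooth f1;
  lf_src : forall a, src (f1 a) = f0 (src a);
  lf_tgt : forall a, tgt (f1 a) = f0 (tgt a);
  lf_unit : forall x, f1 (gunit x) = gunit (f0 x);
  lf_comp : forall b a e e', f1 (gcomp b a e) = gcomp (f1 b) (f1 a) e'
}.

Section ProductGroupoid.
Variables X Y : groupoid R.

Definition prod_src (a : mor X * mor Y) : obj X * obj Y := (src a.1, src a.2).
Definition prod_tgt (a : mor X * mor Y) : obj X * obj Y := (tgt a.1, tgt a.2).

Lemma prod_composable1 (u : fibprod prod_src prod_tgt) :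
  src (fp1 u).1 = tgt (fp2 u).1.
Proof. by have [] := fpE u. Qed.

Lemma prod_composable2 (u : fibprod prod_src prod_tgt) :
  src (fp1 u).2 = tgt (fp2 u).2.
Proof. by have [] := fpE u. Qed.

Definition prod_groupoid : groupoid R :=
  @Groupoid R (obj X * obj Y)%type (mor X * mor Y)%type prod_src prod_tgt
    (fun u => (gcomp (fp1 u).1 (fp2 u).1 (prod_composable1 u),
               gcomp (fp1 u).2 (fp2 u).2 (prod_composable2 u)))
    (fun x => (gunit x.1, gunit x.2))
    (fun a => (ginv a.1, ginv a.2)).

End ProductGroupoid.
End LieGroupoids.

Record two_group (R : realType) := TwoGroup {
  tg_obj : chartedGroupType R;
  tg_mor : chartedGroupType R;
  tg_src : tg_mor -> tg_obj;
  tg_tgt : tg_mor -> tg_obj;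
  tg_comp : fibprod tg_src tg_tgt -> tg_mor;
  tg_unit : tg_obj -> tg_mor;
  tg_inv : tg_mor -> tg_mor
}.

Definition gpd_of_two_group (R : realType) (GG : two_group R) : groupoid R :=
  @Groupoid R (tg_obj GG) (tg_mor GG) (@tg_src R GG) (@tg_tgt R GG)
    (@tg_comp R GG) (@tg_unit R GG) (@tg_inv R GG).
Coercion gpd_of_two_group : two_group >-> groupoid.

Section TwoBundles.
Context {R : realType}.

Record lie_two_group (GG : two_group R) : Prop := {
  l2g_groupoid : lie_groupoid GG;
  l2g_obj : lie_group (tg_obj GG);
  l2g_mor : lie_group (tg_mor GG);
  l2g_mul : @lie_functor R (prod_groupoid GG GG) GG
    (fun x : tg_obj GG * tg_obj GG => (x.1 * x.2)%g)
    (fun x : tg_mor GG * tg_mor GG => (x.1 * x.2)%g);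
  l2g_inv : @lie_functor R GG GG
    (fun x : tg_obj GG => (x^-1)%g) (fun x : tg_mor GG => (x^-1)%g)
}.

Record principal_two_bundle (GG : two_group R) (EE X : groupoid R)
    (pi0 : obj EE -> obj X) (pi1 : mor EE -> mor X)
    (a0 : obj EE * tg_obj GG -> obj EE)
    (a1 : mor EE * tg_mor GG -> mor EE) : Prop := {
  p2b_two_group : lie_two_group GG;
  p2b_total : lie_groupoid EE;
  p2b_base : lie_groupoid X;
  p2b_proj : lie_functor pi0 pi1;
  p2b_act : @lie_functor R (prod_groupoid EE GG) EE a0 a1;
  p2b_action0 : right_action a0;
  p2b_action1 : right_action a1;
  p2b_principal0 : principal_bundle pi0 a0;
  p2b_principal1 : principal_bundle pi1 a1
}.

Record quasi_connection (GG : two_group R) (EE X : groupoid R)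
    (pi0 : obj EE -> obj X) (pi1 : mor EE -> mor X)
    (a0 : obj EE * tg_obj GG -> obj EE) (a1 : mor EE * tg_mor GG -> mor EE)
    (C : fibprod (@src R X) pi0 -> mor EE) : Prop := {
  qc_smooth : smooth C;
  qc_src : forall u, src (C u) = fp2 u;
  qc_proj : forall u, pi1 (C u) = fp1 u;
  qc_equiv : forall gamma p g e e',
    C (fpair gamma (a0 (p, g)) e') = a1 (C (fpair gamma p e), tg_unit g)
}.

Record quasi_principal_two_bundle (GG : two_group R) (EE X : groupoid R)
    (pi0 : obj EE -> obj X) (pi1 : mor EE -> mor X)
    (a0 : obj EE * tg_obj GG -> obj EE) (a1 : mor EE * tg_mor GG -> mor EE)
    (C : fibprod (@src R X) pi0 -> mor EE) : Prop := {
  qp2b_bundle : principal_two_bundle pi0 pi1 a0 a1;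
  qp2b_connection : quasi_connection pi1 a0 a1 C
}.

Record categorical_connection (GG : two_group R) (EE X : groupoid R)
    (pi0 : obj EE -> obj X) (pi1 : mor EE -> mor X)
    (a0 : obj EE * tg_obj GG -> obj EE) (a1 : mor EE * tg_mor GG -> mor EE)
    (C : fibprod (@src R X) pi0 -> mor EE) : Prop := {
  cc_quasi : quasi_connection pi1 a0 a1 C;
  cc_unit : forall x p e, pi0 p = x -> C (fpair (gunit x) p e) = gunit p;
  cc_comp : forall gamma2 gamma1 p1 p2 e21 e1 e2 e ec,
    p2 = tgt (C (fpair gamma1 p1 e1)) ->
    C (fpair (gcomp gamma2 gamma1 e21) p1 e) =
    gcomp (C (fpair gamma2 p2 e2)) (C (fpair gamma1 p1 e1)) ec
}.

End TwoBundles.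

Record crossed_module (R : realType) (G H : chartedGroupType R) := CrossedModule {
  tau : H -> G;
  alpha : G -> H -> H;
  cm_lieG : lie_group G;
  cm_lieH : lie_group H;
  cm_tau_smooth : smooth tau;
  cm_tauM : forall h h', tau (h * h')%g = (tau h * tau h')%g;
  cm_alpha_smooth : smooth (fun x : G * H => alpha x.1 x.2);
  cm_alphaM : forall g h h', alpha g (h * h')%g = (alpha g h * alpha g h')%g;
  cm_alpha1 : forall h, alpha 1%g h = h;
  cm_alpha_act : forall g g' h, alpha (g * g')%g h = alpha g (alpha g' h);
  cm_tau_alpha : forall g h, tau (alpha g h) = (g * tau h * g^-1)%g;
  cm_alpha_tau : forall h h', alpha (tau h) h' = (h * h' * h^-1)%g
}.

Section SemidirectProduct.
Context {R : realType} {G H : chartedGroupType R}.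
Variable cm : crossed_module G H.

Definition semidirect (_ : crossed_module G H) : Type := (H * G)%type.
Local Notation HG := (semidirect cm).

HB.instance Definition _ := Charted.copy HG (H * G)%type.

Definition sd_mul (x y : HG) : HG :=
  ((x.1 * alpha cm x.2 y.1)%g, (x.2 * y.2)%g).
Definition sd_one : HG := (1%g, 1%g).
Definition sd_inv (x : HG) : HG :=
  (alpha cm (x.2^-1)%g (x.1^-1)%g, (x.2^-1)%g).

Lemma alpha_one g : alpha cm g 1%g = 1%g.
Proof.
by apply: (@mulgI _ (alpha cm g 1%g)); rewrite -cm_alphaM !mulg1.
Qed.

Lemma sd_mulA : associative sd_mul.
Proof.
by move=> x y z; rewrite /sd_mul /= cm_alphaM cm_alpha_act !mulgA.
Qed.

Lemma sd_mul1 : left_id sd_one sd_mul.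
Proof. by case=> h g; rewrite /sd_mul /= cm_alpha1 !mul1g. Qed.

Lemma sd_mulg1 : right_id sd_one sd_mul.
Proof. by case=> h g; rewrite /sd_mul /= alpha_one !mulg1. Qed.

Lemma sd_mulV : left_inverse sd_one sd_inv sd_mul.
Proof.
by case=> h g; rewrite /sd_mul /= -cm_alphaM !mulVg alpha_one.
Qed.

Lemma sd_mulgV : right_inverse sd_one sd_inv sd_mul.
Proof.
by case=> h g; rewrite /sd_mul /= -cm_alpha_act !mulgV cm_alpha1 mulgV.
Qed.

HB.instance Definition _ := isGroup.Build HG sd_mulA sd_mul1 sd_mulg1 sd_mulV sd_mulgV.

Definition cm_src (x : HG) : G := x.2.
Definition cm_tgt (x : HG) : G := (tau cm x.1 * x.2)%g.

Definition cm_two_group : two_group R :=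
  @TwoGroup R G HG cm_src cm_tgt
    (fun u => ((fp1 u).1 * (fp2 u).1, (fp2 u).2)%g)
    (fun g => (1%g, g))
    (fun x => ((x.1^-1)%g, cm_tgt x)).

End SemidirectProduct.

Record quasi_principal_bundle (R : realType) (G : chartedGroupType R)
    (X : groupoid R) := QuasiPrincipalBundle {
  tot : chartedType R;
  bproj : tot -> obj X;
  ract : tot * G -> tot;
  mu : fibprod (@src R X) bproj -> tot;
  qpb_base : lie_groupoid X;
  qpb_principal : principal_bundle bproj ract;
  qpb_mu_smooth : smooth mu;
  qpb_mu_proj : forall u, bproj (mu u) = tgt (fp1 u);
  qpb_mu_equiv : forall gamma p g e e',
    mu (fpair gamma (ract (p, g)) e') = ract (mu (fpair gamma p e), g)
}.
Arguments bproj {R G X q} _.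
Arguments ract {R G X q} _.
Arguments mu {R G X q} _.

Section Decorated.
Context {R : realType} {G H : chartedGroupType R} {X : groupoid R}.
Variables (E : quasi_principal_bundle G X) (cm : crossed_module G H).
Variables (Hu : tot E -> H) (Hm : fibprod (@src R X) (@tgt R X) -> H).

Local Notation muE := (@mu R G X E).
Local Notation piE := (@bproj R G X E).

(* An expression makes sense if its arguments lie in the relevant fibre       *)
(* products; the hypotheses e, e', ... express this.                          *)
Record coherent : Prop := {
  coh_a : forall p e,
    muE (fpair (gunit (piE p)) p e) = ract (p, tau cm (Hu p));
  coh_b : forall g2 g1 p e21 e1 e2 e,
    muE (fpair g2 (muE (fpair g1 p e1)) e2) =
    ract (muE (fpair (gcomp g2 g1 e21) p e), tau cm (Hm (fpair g2 g1 e21)));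
  coh_c : forall gamma p e,
    src gamma = piE p -> Hm (fpair gamma (gunit (piE p)) e) = Hu p;
  coh_d : forall gamma p e e',
    Hm (fpair (gunit (piE (muE (fpair gamma p e)))) gamma e') =
    Hu (muE (fpair gamma p e));
  coh_e : forall p g, Hu (ract (p, g)) = Hu p;
  coh_f : forall g p, alpha cm (g^-1)%g (Hu p) = Hu p;
  coh_g : forall p h, (Hu p * h)%g = (h * Hu p)%g;
  coh_h : forall g u, alpha cm (g^-1)%g ((Hm u)^-1)%g = ((Hm u)^-1)%g;
  coh_i : forall u h, (Hm u * h)%g = (h * Hm u)%g;
  coh_j : forall g3 g2 g1 e32 e21 e32_1 e3_21,
    ((Hm (fpair g3 g2 e32))^-1 *
       (Hm (fpair (gcomp g3 g2 e32) g1 e32_1))^-1)%g =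
    ((Hm (fpair g2 g1 e21))^-1 *
       (Hm (fpair g3 (gcomp g2 g1 e21) e3_21))^-1)%g;
  coh_k : forall gamma p e e' e'',
    (Hm (fpair (ginv gamma) gamma e') * (Hm (fpair gamma (ginv gamma) e''))^-1)%g =
    ((Hu p)^-1 * Hu (muE (fpair gamma p e)))%g
}.

Definition qdec_mor : chartedType R := (fibprod (@src R X) piE * H)%type.
Implicit Types a : qdec_mor.

Definition qdec_src a : tot E := fp2 a.1.
Definition qdec_tgt a : tot E := ract (muE a.1, tau cm (a.2^-1)%g).

Lemma proj_qdec_tgt a : piE (qdec_tgt a) = tgt (fp1 a.1).
Proof. by rewrite /qdec_tgt (pb_fibre (qpb_principal E)) qpb_mu_proj. Qed.

Lemma qdec_composable (u : fibprod qdec_src qdec_tgt) :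
  src (fp1 (fp1 u).1) = tgt (fp1 (fp2 u).1).
Proof. by rewrite -proj_qdec_tgt -(fpE u) (fpE (fp1 u).1). Qed.

Lemma qdec_comp_fibre (u : fibprod qdec_src qdec_tgt) :
  src (gcomp (fp1 (fp1 u).1) (fp1 (fp2 u).1) (qdec_composable u)) =
  piE (fp2 (fp2 u).1).
Proof. by rewrite (lg_src_comp (qpb_base E)) (fpE (fp2 u).1). Qed.

Definition qdec_comp (u : fibprod qdec_src qdec_tgt) : qdec_mor :=
  (fpair (gcomp (fp1 (fp1 u).1) (fp1 (fp2 u).1) (qdec_composable u))
     (fp2 (fp2 u).1) (qdec_comp_fibre u),
   ((fp1 u).2 * (fp2 u).2 *
     (Hm (fpair (fp1 (fp1 u).1) (fp1 (fp2 u).1) (qdec_composable u)))^-1)%g).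

Definition qdec_unit (p : tot E) : qdec_mor :=
  (fpair (gunit (piE p)) p (lg_src_unit (qpb_base E) (piE p)), Hu p).

Lemma qdec_inv_fibre a : src (ginv (fp1 a.1)) = piE (qdec_tgt a).
Proof. by rewrite proj_qdec_tgt (lg_src_inv (qpb_base E)). Qed.

Definition qdec_inv a : qdec_mor :=
  (fpair (ginv (fp1 a.1)) (qdec_tgt a) (qdec_inv_fibre a),
   (Hu (fp2 a.1) *
    Hm (fpair (ginv (fp1 a.1)) (fp1 a.1) (lg_src_inv (qpb_base E) (fp1 a.1))) *
    a.2^-1)%g).

Definition qdec_groupoid : groupoid R :=
  Groupoid qdec_comp qdec_unit qdec_inv.

Definition qdec_proj a : mor X := fp1 a.1.

Lemma qdec_act_fibre a (g : G) : src (fp1 a.1) = piE (ract (fp2 a.1, g)).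
Proof. by rewrite (pb_fibre (qpb_principal E)) (fpE a.1). Qed.

Definition qdec_act (x : qdec_mor * semidirect cm) : qdec_mor :=
  let: (a, (h', g)) := x in
  (fpair (fp1 a.1) (ract (fp2 a.1, g)) (qdec_act_fibre a g),
   alpha cm (g^-1)%g (h'^-1 * a.2)%g).

Definition qdec_connection (u : fibprod (@src R X) piE) : qdec_mor := (u, 1%g).

End Decorated.

(* Main.v *)
Require Import Defs.
From HB Require Import structures.
From mathcomp Require Import all_boot all_order all_algebra.
From mathcomp Require Import all_classical all_reals all_analysis.

(** The algebra is a computation with the coherence properties. The arrows of the
    decorated groupoid compose as in [X], and their components in [H] multiply up
    to the central elements [Hm (g2, g1)], which act trivially under [alpha]:
    property (j) is associativity, (c), (d) and (e) are the unit laws, (k) makes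
    the left inverse a right inverse, and (a) and (b) say that sources and targets
    match ([groupoid_laws_qdec]). The action is functorial because [Hu] and [Hm]
    are invariant under [alpha], by (f) and (h), together with the Peiffer
    identity ([lie_functor_qdec_act]). The horizontal arrows [(g, p, 1)] are closed
    under units and composition exactly if [Hu] and [Hm] are trivial
    ([categorical_connection_qdec]).

    The analytic part is to show that [s^*E * H] and the space of composable pairs
    of the decorated groupoid are embedded submanifolds, that the structure maps
    are smooth, and that source and target are submersions. Normally this rests on
    the implicit function theorem, but here every fibre product can be exhibited
    as a graph. Over an open set on which the principal bundle is trivial, the
    pullback [s^*E] is the graph of [s] over [X_1 * G] ([slice_pullback]). In the
    same way, a composable pair [((g2, p2, h2), (g1, p1, h1))] is determined by the
    composable pair [(g2, g1)] of [X] together with [h2], [h1] and the fibre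
    coordinate of [p1], because [p2] is the target of the second arrow
    ([slice_qdec_composable]); and the space of composable pairs of [X] has slice
    charts because the composition of [X] is smooth on it ([slice_composable]).
    Graphs over slices are slices ([slice_graph]), as is seen by subtracting the
    function in a chart.

    A map into an embedded submanifold is smooth as soon as its composite with the
    inclusion is ([smooth_at_sub_of_val]), so that the smoothness of all structure
    maps reduces to closure of smooth maps under composition and pairing, which in
    turn comes down to the chain rule for C^k maps ([Ck_comp]). In local
    coordinates the source map forgets the component in [H] and applies [s * id]
    followed by a trivialization; hence it is a submersion
    ([submersion_pullback_snd]). The target map is its composite with the
    inversion, which is an involution. Finally the decorated bundle is trivial
    over the preimage under [s] of an open set over which the bundle [E] is
    ([principal_bundle_qdec]). *)

Import Order.TTheory GRing.Theory Num.Theory.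
Import numFieldNormedType.Exports.

Set Implicit Arguments.
Unset Strict Implicit.
Unset Printing Implicit Defensive.

Local Open Scope classical_set_scope.
Local Open Scope ring_scope.

(** * Smooth maps between Euclidean spaces *)

Section Calculus.
Context {R : realType}.

Lemma row_mx_linear n m (a : 'rV[R]_n) (b : 'rV[R]_m) :
  row_mx a b = mulmxr (row_mx 1%:M 0) a + mulmxr (row_mx 0 1%:M) b.
Proof.
by rewrite /= !mul_mx_row !mulmx1 !mulmx0 add_row_mx addr0 add0r.
Qed.

Lemma continuous_linear n m (L : {linear 'rV[R]_n -> 'rV[R]_m}) : continuous L.
Proof.
move=> x; apply: differentiable_continuous.
have -> : (L : 'rV[R]_n -> 'rV[R]_m) =
   \sum_(j < n) (fun y : 'rV[R]_n => y 0 j *: L (delta_mx 0 j)).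
  apply/funext => y; rewrite fct_sumE {1}(row_sum_delta y) linear_sum.
  by apply: eq_bigr => j _; rewrite linearZ.
apply: differentiable_sum => j; apply: differentiableZl.
exact: differentiable_coord.
Qed.

Lemma near_eq_differentiable (V W : normedModType R) (f g : V -> W) (x : V) :
  (\forall y \near x, f y = g y) -> differentiable f x -> differentiable g x.
Proof.
move=> fg df; have fgx : f x = g x by exact: nbhs_singleton fg.
have fg0 : \forall h \near (0 : V), f (h + x) = g (h + x).
  by move: fg; rewrite (near_shift 0) subr0.
have [cf fE] := (diff_locallyP _ _).1 df.
have gE : g \o shift x = cst (g x) + 'd f x +o_ (0 : V) id.
  apply/eqaddoP => e e0; have := (eqaddoP _ _ _ _).1 fE e e0.
  by apply: filterS2 fg0 => h /= eh; rewrite !fctE /= eh fgx.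
by apply/diff_locallyP; rewrite (diff_unique cf gE); split.
Qed.

(** Reduced, coordinate by coordinate, to the product rule for real-valued
    functions. *)
Lemma scale_diff n m (k : 'rV[R]_n -> R) (f : 'rV[R]_n -> 'rV[R]_m)
    (x : 'rV[R]_n) :
  differentiable k x -> differentiable f x ->
  differentiable (fun y => k y *: f y) x /\
  forall v, 'D_v (fun y => k y *: f y) x = 'D_v k x *: f x + k x *: 'D_v f x.
Proof.
move=> dk df.
have dfj j : differentiable (fun y => f y 0 j : R) x.
  apply: (@differentiable_comp _ _ _ _ f (fun N : 'rV[R]_m => N 0 j : R)) => //.
  exact: differentiable_coord.
have D : differentiable (fun y => k y *: f y) x.
  have -> : (fun y => k y *: f y) =
      \sum_(j < m) (fun y => (k y * f y 0 j) *: (delta_mx 0 j : 'rV[R]_m)).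
    apply/funext => y; rewrite fct_sumE {1}(row_sum_delta (f y)) scaler_sumr.
    by apply: eq_bigr => j _; rewrite scalerA.
  apply: differentiable_sum => j; apply: differentiableZl.
  exact: differentiableM.
split=> // v; rewrite derive_mx; last exact: diff_derivable.
rewrite (@derive_mx _ _ _ _ f x v); last exact: diff_derivable.
apply/matrixP => i j; rewrite !mxE !ord1.
under eq_fun do rewrite mxE.
rewrite deriveM; try exact: diff_derivable.
by rewrite -!/(_ *: _) /GRing.scale /= addrC (mulrC (f x 0 j)).
Qed.


Lemma Ck_sub n m k (U V : set 'rV[R]_n) (f : 'rV[R]_n -> 'rV[R]_m) :
  V `<=` U -> Ck k U f -> Ck k V f.
Proof.
move=> VU; elim: k f => [|k IH] f; first by move=> cf x /VU; exact: cf.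
move=> [df Df]; split; first by move=> x /VU; exact: df.
by move=> v; apply: IH; exact: Df.
Qed.

Lemma CkS n m k (U : set 'rV[R]_n) (f : 'rV[R]_n -> 'rV[R]_m) :
  Ck k.+1 U f -> Ck k U f.
Proof.
elim: k f => [|k IH] f [df Df].
  by move=> x Ux; apply: differentiable_continuous; exact: df.
by split=> // v; apply: IH; exact: Df.
Qed.

Lemma Ck_eq n m k (U : set 'rV[R]_n) (f g : 'rV[R]_n -> 'rV[R]_m) :
  open U -> (forall x, U x -> f x = g x) -> Ck k U f -> Ck k U g.
Proof.
move=> oU; elim: k f g => [|k IH] f g fg.
  move=> cf x Ux; have fgx : \forall y \near x, f y = g y.
    by apply: filterS (open_nbhs_nbhs (conj oU Ux)) => y; exact: fg.
  change (g @ x --> g x); rewrite -(fg _ Ux).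
  have cfx : f @ x --> f x := cf x Ux.
  by apply: cvg_trans cfx; exact: near_eq_cvg fgx.
have fgn x : U x -> \forall y \near x, f y = g y.
  by move=> Ux; apply: filterS (open_nbhs_nbhs (conj oU Ux)) => y; exact: fg.
move=> [df Df]; split.
  by move=> x Ux; exact: near_eq_differentiable (fgn x Ux) (df x Ux).
move=> v; apply: IH (Df v) => x Ux; apply: near_eq_derive; exact: fgn.
Qed.

Section Closure.
Context {n : nat} {U : set 'rV[R]_n}.
Hypothesis oU : open U.

Lemma Ck_cst m k (a : 'rV[R]_m) : Ck k U (fun _ => a).
Proof.
elim: k a => [|k IH] a /=; first by move=> x _; exact: cst_continuous.
split; first by move=> x _; exact: differentiable_cst.
move=> v; have -> : (fun x => 'D_v (fun=> a) x) = (fun _ : 'rV[R]_n => 0).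
  by apply/funext => x; rewrite derive_cst.
exact: IH.
Qed.

Lemma Ck_add m k (f g : 'rV[R]_n -> 'rV[R]_m) :
  Ck k U f -> Ck k U g -> Ck k U (fun x => f x + g x).
Proof.
elim: k f g => [|k IH] f g /=.
  by move=> cf cg x Ux; apply: continuousD; [exact: cf|exact: cg].
move=> [df Df] [dg Dg]; split.
  by move=> x Ux; apply: differentiableD; [exact: df|exact: dg].
move=> v; apply: Ck_eq (IH _ _ (Df v) (Dg v)) => // x Ux.
by apply/esym/(@deriveD _ _ _ f g); apply: diff_derivable; [exact: df|exact: dg].
Qed.

Lemma Ck_scale m p k (i : 'I_p) (a : 'rV[R]_n -> 'rV[R]_p)
    (f : 'rV[R]_n -> 'rV[R]_m) :
  Ck k U a -> Ck k U f -> Ck k U (fun x => a x 0 i *: f x).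
Proof.
elim: k a f => [|k IH] a f.
  move=> ca cf x Ux /=; apply: continuousZ; last exact: cf.
  apply: (@continuous_comp _ _ _ a (fun N : 'rV[R]_p => N 0 i)); first exact: ca.
  exact: coord_continuous.
move=> Ca Cf; have [[da Da] [df Df]] := (Ca, Cf).
have dai x : U x -> differentiable (fun y => a y 0 i : R) x.
  move=> Ux; apply: (@differentiable_comp _ _ _ _ a (fun N : 'rV[R]_p => N 0 i : R)).
    exact: da.
  exact: differentiable_coord.
split; first by move=> x Ux; have [] := scale_diff (dai x Ux) (df x Ux).
move=> v.
apply: Ck_eq (Ck_add (IH _ _ (Da v) (CkS Cf)) (IH _ _ (CkS Ca) (Df v))) => // x Ux.
rewrite (scale_diff (dai x Ux) (df x Ux)).2 derive_mx ?mxE//.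
by apply: diff_derivable; exact: da.
Qed.

Lemma Ck_sum m k (I : Type) (s : seq I) (f : I -> 'rV[R]_n -> 'rV[R]_m) :
  (forall i, Ck k U (f i)) -> Ck k U (fun x => \sum_(i <- s) f i x).
Proof.
move=> cf; elim: s => [|i s IH].
  by apply: Ck_eq (Ck_cst k 0) => // x _; rewrite big_nil.
by apply: Ck_eq (Ck_add (cf i) IH) => // x _; rewrite big_cons.
Qed.

Lemma Ck_linear m p k (L : {linear 'rV[R]_m -> 'rV[R]_p})
    (f : 'rV[R]_n -> 'rV[R]_m) : Ck k U f -> Ck k U (fun x => L (f x)).
Proof.
elim: k f => [|k IH] f.
  by move=> cf x Ux; apply: continuous_comp (cf x Ux) _; exact: continuous_linear.
move=> [df Df]; have dL y : differentiable L y.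
  by apply: linear_differentiable; exact: continuous_linear.
have dLf x : U x -> differentiable (fun y => L (f y)) x.
  by move=> Ux; apply: (@differentiable_comp _ _ _ _ f L) => //; exact: df.
split=> // v; apply: Ck_eq (IH _ (Df v)) => // x Ux.
have [dfx dLfx] := (df x Ux, dLf x Ux).
rewrite (deriveE v dfx) (deriveE v dLfx) (@diff_comp _ _ _ _ f L)//=.
by rewrite diff_lin//; exact: continuous_linear.
Qed.

Lemma Ck_id k : Ck k U id.
Proof.
case: k => [|k] /=; first by move=> x _; exact: cvg_id.
split; first by move=> x _; have [] := is_diff_id x.
by move=> v; apply: Ck_eq (Ck_cst k v) => // x _; rewrite derive_id.
Qed.

End Closure.

(** By the chain rule, [D_v (g \o f)] is the sum of the products of the [i]-th
    coordinate of [D_v f] by [(D_(e_i) g) \o f]. The induction goes through as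
    [f] and [D_(e_i) g] are of class C^k. *)
Lemma Ck_comp n m p k (U : set 'rV[R]_n) (V : set 'rV[R]_m)
    (f : 'rV[R]_n -> 'rV[R]_m) (g : 'rV[R]_m -> 'rV[R]_p) :
  open U -> (forall x, U x -> V (f x)) ->
  Ck k U f -> Ck k V g -> Ck k U (g \o f).
Proof.
move=> oU UV; elim: k g => [|k IH] g.
  by move=> cf cg x Ux; apply: continuous_comp; [exact: cf|exact/cg/UV].
move=> Cf [dg Dg]; have [df Df] := Cf.
have D x : U x -> differentiable (g \o f) x.
  by move=> Ux; apply: differentiable_comp; [exact: df|exact/dg/UV].
split=> // v.
have S : Ck k U (fun x => \sum_(i < m) 'D_v f x 0 i *: 'D_(delta_mx 0 i) g (f x)).
  apply: Ck_sum => // i; apply: Ck_scale (Df v) _ => //.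
  exact: IH (CkS Cf) (Dg _).
apply: Ck_eq S => // x Ux.
have [dfx dgx] := (df x Ux, dg _ (UV _ Ux)).
rewrite (deriveE v (D x Ux)) diff_comp//= -(deriveE v dfx).
rewrite [in RHS](row_sum_delta ('D_v f x)) linear_sum; apply: eq_bigr => i _.
by rewrite linearZ (deriveE _ dgx).
Qed.

Lemma smooth_near_differentiable n m (f : 'rV[R]_n -> 'rV[R]_m) x :
  smooth_near f x -> differentiable f x.
Proof. by move=> [U [_ Ux /(_ 1%N) [df _]]]; exact: df. Qed.

Lemma smooth_near_continuous n m (f : 'rV[R]_n -> 'rV[R]_m) x :
  smooth_near f x -> {for x, continuous f}.
Proof. by move/smooth_near_differentiable/differentiable_continuous. Qed.

Lemma smooth_near_comp n m p (f : 'rV[R]_n -> 'rV[R]_m)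
    (g : 'rV[R]_m -> 'rV[R]_p) x :
  smooth_near f x -> smooth_near g (f x) -> smooth_near (g \o f) x.
Proof.
move=> [U [oU Ux Cf]] [V [oV Vfx Cg]].
have oW : open (U `&` f @^-1` V).
  rewrite openE => y [Uy Vy]; apply: filterI; first exact: open_nbhs_nbhs.
  by apply: (Cf 0%N y Uy); exact: open_nbhs_nbhs.
exists (U `&` f @^-1` V); split=> // k.
by apply: Ck_comp (Cg k) => //; [move=> y []|apply: Ck_sub (Cf k) => y []].
Qed.

Lemma smooth_near_linear n m (L : {linear 'rV[R]_n -> 'rV[R]_m}) x :
  smooth_near L x.
Proof.
exists setT; split=> [||k] //; first exact: openT.
by apply: Ck_linear (Ck_id _ _) => //; exact: openT.
Qed.

Lemma smooth_near_id n (x : 'rV[R]_n) : smooth_near id x.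
Proof. by exists setT; split=> [||k] //; [exact: openT|apply: Ck_id; exact: openT]. Qed.

Lemma smooth_near_cst n m (a : 'rV[R]_m) (x : 'rV[R]_n) : smooth_near (fun _ => a) x.
Proof. by exists setT; split=> [||k] //; [exact: openT|apply: Ck_cst; exact: openT]. Qed.

Lemma smooth_near_add n m (f g : 'rV[R]_n -> 'rV[R]_m) x :
  smooth_near f x -> smooth_near g x -> smooth_near (fun y => f y + g y) x.
Proof.
move=> [U [oU Ux Cf]] [V [oV Vx Cg]]; exists (U `&` V).
have oW : open (U `&` V) by exact: openI.
split=> // k; apply: Ck_add => //.
  by apply: Ck_sub (Cf k) => y [].
by apply: Ck_sub (Cg k) => y [].
Qed.

Lemma smooth_near_row_mx n m p (f : 'rV[R]_n -> 'rV[R]_m)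
    (g : 'rV[R]_n -> 'rV[R]_p) x :
  smooth_near f x -> smooth_near g x ->
  smooth_near (fun y => row_mx (f y) (g y)) x.
Proof.
move=> sf sg.
have -> : (fun y => row_mx (f y) (g y)) =
    (fun y => (mulmxr (row_mx 1%:M 0) \o f) y + (mulmxr (row_mx 0 1%:M) \o g) y).
  by apply/funext => y; exact: row_mx_linear.
by apply: smooth_near_add; apply: smooth_near_comp => //; exact: smooth_near_linear.
Qed.

End Calculus.

(** * Smooth maps between spaces with an atlas *)

#[global] Arguments local_rep {R X Y} c d f x g.

Section LocalRepresentatives.
Context {R : realType}.

Lemma chart_image_nbhs (X : topologicalType) (c : chart R X) x (A : set X) :
  is_chart c -> cdom c x -> nbhs x A ->
  nbhs (cmap c x) (cmap c @` (A `&` cdom c)).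
Proof.
move=> [oc _ _ co] cx; rewrite nbhsE => -[B [oB Bx] BA].
have oI : open (cmap c @` (B `&` cdom c)) by apply: co; [exact: openI|move=> y []].
apply: filterS (open_nbhs_nbhs (conj oI _)); last by exists x.
by move=> _ [y [/BA Ay cy] <-]; exists y.
Qed.

Lemma local_rep_value (X Y : topologicalType) (c : chart R X) (d : chart R Y) f x g :
  local_rep c d f x g -> cmap d (f x) = g (cmap c x).
Proof. by move=> [_ _ _ /nbhs_singleton []]. Qed.

(** As [cmap d] is open and injective, the values of [f] near [x] can be read off
    those of the continuous map [g \o cmap c]. *)
Lemma local_rep_continuous (X Y : topologicalType) (c : chart R X)
    (d : chart R Y) f x g :
  is_chart c -> is_chart d -> local_rep c d f x g -> {for x, continuous f}.
Proof.
move=> chc chd rep; have [cx dfx sg nr] := rep; move=> A /= nA.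
have [_ dinj _ _] := chd; have [_ _ cc _] := chc.
have := chart_image_nbhs chd dfx nA; rewrite (local_rep_value rep) => nI.
have cgc : {for x, continuous (g \o cmap c)}.
  by apply: continuous_comp; [exact: cc|exact: smooth_near_continuous].
have := cgc _ nI; rewrite nbhs_simpl /= => nI'.
apply: filterS2 nI' nr => y /= [z [Az dz] zE] [dfy fyE].
by rewrite /= -(dinj z (f y)) ?inE// zE fyE.
Qed.

Lemma local_rep_comp (X Y Z : topologicalType) (c : chart R X) (d : chart R Y)
    (e : chart R Z) f h x g k :
  is_chart c -> is_chart d ->
  local_rep c d f x g -> local_rep d e h (f x) k ->
  local_rep c e (h \o f) x (k \o g).
Proof.
move=> chc chd rf rh; have cf := local_rep_continuous chc chd rf.
have fE := local_rep_value rf.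
move: rf rh => [cx dfx sg nf] [_ ehfx sk nh]; split=> //.
  by apply: smooth_near_comp => //; rewrite -fE.
have nh' := cf _ nh; rewrite nbhs_simpl /= in nh'.
by apply: filterS2 nh' nf => y /= [ey hE] [dy gE]; rewrite hE gE.
Qed.

Lemma local_rep_eq (X Y : topologicalType) (c : chart R X) (d : chart R Y) f f' x g :
  (\forall y \near x, f y = f' y) -> local_rep c d f x g -> local_rep c d f' x g.
Proof.
move=> ff [cx dx sg nf]; split=> //; first by rewrite -(nbhs_singleton ff).
by apply: filterS2 ff nf => y ->.
Qed.

Lemma local_rep_id (X : topologicalType) (c : chart R X) x :
  is_chart c -> cdom c x -> local_rep c c id x id.
Proof.
move=> [oc _ _ _] cx; split=> //; first exact: smooth_near_id.
have nc : nbhs x (cdom c) by exact: open_nbhs_nbhs.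
by apply: filterS nc.
Qed.

(** Charts have open images, so that the values of [cmap c] near [x] fill a
    neighbourhood of [cmap c x]. *)
Lemma local_rep_unique (X Y : topologicalType) (c : chart R X) (d : chart R Y) f x g g' :
  is_chart c -> local_rep c d f x g -> local_rep c d f x g' ->
  \forall v \near cmap c x, g v = g' v.
Proof.
move=> chc [cx _ _ ng] [_ _ _ ng'].
apply: filterS (chart_image_nbhs chc cx (filterI ng ng')).
by move=> _ [y [[[_ e1] [_ e2]] _] <-]; rewrite -e1 -e2.
Qed.

End LocalRepresentatives.

Section SmoothSpaces.
Context {R : realType}.

(** The part of the notion of manifold on which the calculus of smooth maps rests.
    It suffices for the spaces of composable pairs, which only serve as domains of
    smooth maps. As a class, it is inferred for products and fibre products. *)
Record smooth_space (M : chartedType R) : Prop := {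
  ss_cover : forall x : M, exists2 c, (atlas : set (chart R M)) c & cdom c x;
  ss_chart : forall c : chart R M, atlas c -> is_chart c;
  ss_compat : forall c d : chart R M, atlas c -> atlas d -> compatible c d
}.

Existing Class smooth_space.

Lemma manifold_smooth_space (M : chartedType R) : manifold M -> smooth_space M.
Proof. by case=> ? ? ? ? ? ?; split. Qed.

(** The charts of the maximal atlas, as slice charts are restrictions of these. *)
Definition max_chart (M : chartedType R) (c : chart R M) : Prop :=
  is_chart c /\ forall d, atlas d -> compatible c d.

Lemma atlas_max (M : chartedType R) (c : chart R M) :
  smooth_space M -> atlas c -> max_chart c.
Proof. by case=> _ ch co ac; split; [exact: ch|move=> d; exact: co]. Qed.

(** Smoothness provides a representative in one pair of charts; composing it with
    transitions gives one in any other pair of charts. *)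
Lemma smooth_at_rep (M N : chartedType R) (c : chart R M) (d : chart R N)
    (f : M -> N) x :
  smooth_space M -> smooth_space N -> max_chart c -> max_chart d ->
  cdom c x -> cdom d (f x) -> smooth_at f x -> exists g, local_rep c d f x g.
Proof.
move=> sM sN [chc mc] [chd md] cx dx [c' [d' [g [ac ad rep]]]].
have [c'x d'x _ _] := rep.
have [[g1 r1] _] := mc _ ac _ cx c'x.
have [_ [g2 r2]] := md _ ad _ dx d'x.
exists (g2 \o (g \o g1)).
have [chc' chd'] := (ss_chart sM ac, ss_chart sN ad).
have r3 := local_rep_comp (f := id) (h := f) chc chc' r1 rep.
exact: (local_rep_comp (h := id) chc chd' r3 r2).
Qed.

Lemma smooth_at_of_rep (M N : chartedType R) (c : chart R M) (d : chart R N)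
    (f : M -> N) x g :
  smooth_space M -> smooth_space N -> max_chart c -> max_chart d ->
  local_rep c d f x g -> smooth_at f x.
Proof.
move=> sM sN [chc mc] [chd md] rep; have [cx dx _ _] := rep.
have [c' ac c'x] := ss_cover sM x; have [d' ad d'x] := ss_cover sN (f x).
have [_ [g1 r1]] := mc _ ac _ cx c'x.
have [[g2 r2] _] := md _ ad _ dx d'x.
exists c', d', (g2 \o (g \o g1)); split=> //.
have chc' := ss_chart sM ac.
apply: (local_rep_comp (h := id) (d := d)) r2 => //.
exact: (local_rep_comp (f := id) (d := c)) rep.
Qed.

Lemma smooth_at_continuous (M N : chartedType R) {sM : smooth_space M}
    {sN : smooth_space N} (f : M -> N) x :
  smooth_at f x -> {for x, continuous f}.
Proof.
move=> [c [d [g [ac ad rep]]]].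
by apply: local_rep_continuous rep; [exact: ss_chart ac|exact: ss_chart ad].
Qed.

Lemma smooth_at_comp (M N P : chartedType R) {sM : smooth_space M}
    {sN : smooth_space N} {sP : smooth_space P} (f : M -> N) (h : N -> P) x :
  smooth_at f x -> smooth_at h (f x) -> smooth_at (h \o f) x.
Proof.
move=> sf sh; have [c [d [g [ac ad rep]]]] := sf.
have [d' [e [k [ad' ae reph]]]] := sh.
have [_ dfx _ _] := rep; have [_ efx _ _] := reph.
have [k' rk] := smooth_at_rep sN sP (atlas_max sN ad) (atlas_max sP ae) dfx efx sh.
exists c, e, (k' \o g); split=> //.
exact: local_rep_comp (ss_chart sM ac) (ss_chart sN ad) rep rk.
Qed.

Lemma smooth_at_eq (M N : chartedType R) (f f' : M -> N) x :
  (\forall y \near x, f y = f' y) -> smooth_at f x -> smooth_at f' x.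
Proof.
move=> ff [c [d [g [ac ad rep]]]]; exists c, d, g; split=> //.
exact: local_rep_eq ff rep.
Qed.

Lemma smooth_at_id (M : chartedType R) {sM : smooth_space M} (x : M) : smooth_at id x.
Proof.
have [c ac cx] := ss_cover sM x; exists c, c, id; split=> //.
exact: local_rep_id (ss_chart sM ac) cx.
Qed.

Lemma smooth_at_cst (M N : chartedType R) {sM : smooth_space M}
    {sN : smooth_space N} (x : M) (y : N) : smooth_at (fun _ => y) x.
Proof.
have [c ac cx] := ss_cover sM x; have [d ad dy] := ss_cover sN y.
exists c, d, (fun _ => cmap d y); split=> //; split=> //; first exact: smooth_near_cst.
by apply: nearW => z; split.
Qed.

(** * Products of spaces with an atlas *)

Lemma continuous_row_mx (T : topologicalType) n m (f : T -> 'rV[R]_n)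
    (g : T -> 'rV[R]_m) x :
  {for x, continuous f} -> {for x, continuous g} ->
  {for x, continuous (fun y => row_mx (f y) (g y))}.
Proof.
move=> cf cg.
pose L1 : {linear 'rV[R]_n -> 'rV[R]_(n + m)} := mulmxr (row_mx 1%:M 0).
pose L2 : {linear 'rV[R]_m -> 'rV[R]_(n + m)} := mulmxr (row_mx 0 1%:M).
have -> : (fun y => row_mx (f y) (g y)) = (fun y => L1 (f y) + L2 (g y)).
  by apply/funext => y; exact: row_mx_linear.
have c1 : {for x, continuous (L1 \o f)}.
  exact: continuous_comp cf (@continuous_linear R _ _ L1 _).
have c2 : {for x, continuous (L2 \o g)}.
  exact: continuous_comp cg (@continuous_linear R _ _ L2 _).
exact: continuousD c1 c2.
Qed.

Lemma prod_is_chart (X Y : topologicalType) (c : chart R X) (d : chart R Y) :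
  is_chart c -> is_chart d -> is_chart (prod_chart c d).
Proof.
move=> chc chd; have [oc ci cc _] := chc; have [od di dc _] := chd; split=> /=.
- rewrite openE => -[x y] [/= cx dy]; exists (cdom c, cdom d) => //=.
  by split; apply: open_nbhs_nbhs.
- move=> [x y] [x' y'] /set_mem [/= cx dy] /set_mem [/= cx' dy'].
  by move=> /eq_row_mx [cE dE]; rewrite (ci x x') ?inE// (di y y') ?inE.
- move=> [x y] [/= cx dy]; apply: continuous_row_mx.
    by apply: (@continuous_comp _ _ _ fst); [exact: cvg_fst|exact: cc].
  by apply: (@continuous_comp _ _ _ snd); [exact: cvg_snd|exact: dc].
- move=> V oV VU; rewrite openE => _ [[x y] Vxy <-] /=.
  have [/= cx dy] := VU _ Vxy.
  have [[A B] [/= Ax By] ABV] : nbhs (x, y) V by exact: open_nbhs_nbhs.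
  have nA := chart_image_nbhs chc cx Ax; have nB := chart_image_nbhs chd dy By.
  have nl : nbhs (row_mx (cmap c x) (cmap d y)) (lsubmx @^-1` (cmap c @` (A `&` cdom c))).
    by apply: (@continuous_linear R _ _ lsubmx (row_mx _ _)) => /=; rewrite row_mxKl.
  have nr : nbhs (row_mx (cmap c x) (cmap d y)) (rsubmx @^-1` (cmap d @` (B `&` cdom d))).
    by apply: (@continuous_linear R _ _ rsubmx (row_mx _ _)) => /=; rewrite row_mxKr.
  apply: filterS (filterI nl nr) => v [[x' [Ax' _] xE] [y' [By' _] yE]].
  by exists (x', y'); [exact: ABV|rewrite /= xE yE hsubmxK].
Qed.

Lemma local_rep_prod (X Y X' Y' : topologicalType) (c : chart R X) (d : chart R Y)
   (c' : chart R X') (d' : chart R Y') f h x y g k :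
   local_rep c c' f x g -> local_rep d d' h y k ->
   local_rep (prod_chart c d) (prod_chart c' d') (fun z => (f z.1, h z.2)) (x, y)
     (fun v => row_mx (g (lsubmx v)) (k (rsubmx v))).
Proof.
move=> [cx c'x sg ng] [dy d'y sk nk]; split=> //=.
- apply: smooth_near_row_mx.
    apply: (@smooth_near_comp _ _ _ _ lsubmx); first exact: smooth_near_linear.
    by rewrite row_mxKl.
  apply: (@smooth_near_comp _ _ _ _ rsubmx); first exact: smooth_near_linear.
  by rewrite row_mxKr.
- exists ([set x | cdom c' (f x) /\ cmap c' (f x) = g (cmap c x)],
          [set y | cdom d' (h y) /\ cmap d' (h y) = k (cmap d y)]) => //=.
  by move=> [x' y'] [/= [? e1] [? e2]]; rewrite row_mxKl row_mxKr e1 e2.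
Qed.

Lemma max_chart_prod (M N : chartedType R) (c : chart R M) (d : chart R N) :
  max_chart c -> max_chart d -> max_chart (prod_chart c d : chart R (M * N)%type).
Proof.
move=> [chc mc] [chd md]; split; first exact: prod_is_chart.
move=> _ [c' [d' [ac' ad' ->]]] [x y] /= [/= cx dy] [/= c'x d'y].
have E : (fun z : M * N => (id z.1, id z.2)) = id by apply/funext; case.
have [[g1 r1] [g2 r2]] := mc _ ac' _ cx c'x.
have [[k1 s1] [k2 s2]] := md _ ad' _ dy d'y.
split.
  by have := local_rep_prod r1 s1; rewrite E; eexists; eassumption.
by have := local_rep_prod r2 s2; rewrite E; eexists; eassumption.
Qed.

Lemma smooth_space_prod (M N : chartedType R) :
  smooth_space M -> smooth_space N -> smooth_space (M * N)%type.
Proof.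
move=> sM sN; split.
- move=> [x y]; have [c ac cx] := ss_cover sM x; have [d ad dy] := ss_cover sN y.
  by exists (prod_chart c d); [exists c, d|split].
- move=> _ [c [d [ac ad ->]]].
  by apply: prod_is_chart; [exact: ss_chart ac|exact: ss_chart ad].
- move=> _ e' [c [d [ac ad ->]]] ae'.
  exact: (max_chart_prod (atlas_max sM ac) (atlas_max sN ad)).2 _ ae'.
Qed.

Lemma smooth_at_fst (M N : chartedType R) {sM : smooth_space M}
    {sN : smooth_space N} (z : M * N) : smooth_at fst z.
Proof.
move: z => [x y]; have [c ac cx] := ss_cover sM x.
have [d ad dy] := ss_cover sN y.
exists (prod_chart c d), c, lsubmx; split=> //; first by exists c, d.
split=> //=; first exact: smooth_near_linear.
have [oe _ _ _] := prod_is_chart (ss_chart sM ac) (ss_chart sN ad).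
have ne : nbhs ((x, y) : M * N) (cdom (prod_chart c d)) by exact: open_nbhs_nbhs.
by apply: filterS ne => -[x' y'] [/= ? ?]; rewrite row_mxKl.
Qed.

Lemma smooth_at_snd (M N : chartedType R) {sM : smooth_space M}
    {sN : smooth_space N} (z : M * N) : smooth_at snd z.
Proof.
move: z => [x y]; have [c ac cx] := ss_cover sM x.
have [d ad dy] := ss_cover sN y.
exists (prod_chart c d), d, rsubmx; split=> //; first by exists c, d.
split=> //=; first exact: smooth_near_linear.
have [oe _ _ _] := prod_is_chart (ss_chart sM ac) (ss_chart sN ad).
have ne : nbhs ((x, y) : M * N) (cdom (prod_chart c d)) by exact: open_nbhs_nbhs.
by apply: filterS ne => -[x' y'] [/= ? ?]; rewrite row_mxKr.
Qed.

Lemma smooth_at_pair (L M N : chartedType R) {sL : smooth_space L}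
    {sM : smooth_space M} {sN : smooth_space N} (f : L -> M) (h : L -> N) x :
  smooth_at f x -> smooth_at h x -> smooth_at (fun y => (f y, h y)) x.
Proof.
move=> sf sh; have [c ac cx] := ss_cover sL x.
have [d ad dfx] := ss_cover sM (f x); have [e ae ehx] := ss_cover sN (h x).
have mc := atlas_max sL ac.
have [g [_ _ sg ng]] := smooth_at_rep sL sM mc (atlas_max sM ad) cx dfx sf.
have [k [_ _ sk nk]] := smooth_at_rep sL sN mc (atlas_max sN ae) cx ehx sh.
exists c, (prod_chart d e), (fun v => row_mx (g v) (k v)); split=> //.
  by exists d, e.
split=> //=; first exact: smooth_near_row_mx.
by apply: filterS2 ng nk => y [? ->] [? ->].
Qed.

(** * Euclidean spaces as spaces with an atlas *)

(** With this atlas, charts are themselves smooth maps, and so can be composed with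
    the other smooth maps when new charts are built. *)
Definition euclid_atlas n : set (chart R 'rV[R]_n) :=
  [set @Chart R 'rV[R]_n n setT id].

HB.instance Definition _ n := hasAtlas.Build R 'rV[R]_n (@euclid_atlas n).

Lemma smooth_space_euclid n : smooth_space 'rV[R]_n.
Proof.
have ch : is_chart (@Chart R 'rV[R]_n n setT id).
  split; [exact: openT|by []|by move=> x _; exact: cvg_id|].
  by move=> V oV _; rewrite image_id.
split.
- by move=> x; exists (@Chart R 'rV[R]_n n setT id).
- by move=> c ->.
- by move=> c d -> -> x _ _; split; exists id; exact: local_rep_id.
Qed.

Lemma smooth_at_euclid n m (f : 'rV[R]_n -> 'rV[R]_m) x :
  smooth_near f x -> smooth_at f x.
Proof.
move=> sf; exists (@Chart R 'rV[R]_n n setT id), (@Chart R 'rV[R]_m m setT id), f.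
split=> //; split=> //=; have F := @nbhs_filter _ x.
by apply: filterE.
Qed.

Lemma smooth_at_linear n m (L : {linear 'rV[R]_n -> 'rV[R]_m}) x : smooth_at L x.
Proof. exact/smooth_at_euclid/smooth_near_linear. Qed.
End SmoothSpaces.

(** * Local diffeomorphisms *)

#[global] Existing Instance smooth_space_prod.
#[global] Existing Instance smooth_space_euclid.

Section Diffeos.
Context {R : realType}.

Lemma open_setI_preimage (X Y : topologicalType) (U : set X) (V : set Y) (f : X -> Y) :
  open U -> (forall x, U x -> {for x, continuous f}) -> open V ->
  open (U `&` f @^-1` V).
Proof.
move=> oU cf oV; rewrite openE => x [Ux Vx].
have nU : nbhs x U by exact: open_nbhs_nbhs.
have nV : nbhs (f x) V by exact: open_nbhs_nbhs.
exact: filterI nU (cf x Ux _ nV).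
Qed.

Lemma smooth_at_ext (M N : chartedType R) (f f' : M -> N) x :
  f =1 f' -> smooth_at f x -> smooth_at f' x.
Proof. by move=> /funext ->. Qed.

(** Read in the product of the trivial charts, [row_mx] is the identity. *)
Lemma smooth_at_row_mx (M : chartedType R) {sM : smooth_space M} n m
    (f : M -> 'rV[R]_n) (g : M -> 'rV[R]_m) x :
  smooth_at f x -> smooth_at g x -> smooth_at (fun y => row_mx (f y) (g y)) x.
Proof.
move=> sf sg.
have sr (z : 'rV[R]_n * 'rV[R]_m) : smooth_at (fun z => row_mx z.1 z.2) z.
  exists (prod_chart (@Chart R 'rV[R]_n n setT id) (@Chart R 'rV[R]_m m setT id)).
  exists (@Chart R 'rV[R]_(n + m) _ setT id), id; split=> //.
    by exists (@Chart R 'rV[R]_n n setT id), (@Chart R 'rV[R]_m m setT id).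
  split=> //=; first exact: smooth_near_id.
  by have F := @nbhs_filter _ z; apply: filterE.
exact: (smooth_at_comp (smooth_at_pair sf sg) (sr _)).
Qed.

Lemma smooth_at_linear_comp (M : chartedType R) {sM : smooth_space M} n m
    (L : {linear 'rV[R]_n -> 'rV[R]_m}) (f : M -> 'rV[R]_n) x :
  smooth_at f x -> smooth_at (fun y => L (f y)) x.
Proof. by move=> sf; apply: smooth_at_comp sf _; exact: smooth_at_linear. Qed.

Lemma smooth_at_add (M : chartedType R) {sM : smooth_space M} n
    (f g : M -> 'rV[R]_n) x :
  smooth_at f x -> smooth_at g x -> smooth_at (fun y => f y + g y) x.
Proof.
move=> sf sg.
apply: (smooth_at_ext _ (smooth_at_linear_comp (mulmxr (col_mx 1%:M 1%:M))
  (smooth_at_row_mx sf sg))) => y /=; by rewrite mul_row_col !mulmx1.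
Qed.

Lemma smooth_at_sub (M : chartedType R) {sM : smooth_space M} n
    (f g : M -> 'rV[R]_n) x :
  smooth_at f x -> smooth_at g x -> smooth_at (fun y => f y - g y) x.
Proof.
move=> sf sg; apply: smooth_at_add => //.
apply: (smooth_at_ext _ (smooth_at_linear_comp (mulmxr (- 1%:M)) sg)) => y /=.
by rewrite mulmxN mulmx1.
Qed.

(** [F] and [G] are mutually inverse diffeomorphisms between the open sets [U] and
    [W]. Like charts, they are total functions whose values elsewhere are
    irrelevant. *)
Record diffeo_on (M N : chartedType R) (U : set M) (W : set N) (F : M -> N)
    (G : N -> M) : Prop := {
  diffeo_openl : open U;
  diffeo_openr : open W;
  diffeo_mapl : forall x, U x -> W (F x);
  diffeo_mapr : forall y, W y -> U (G y);
  diffeo_lK : forall x, U x -> G (F x) = x;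
  diffeo_rK : forall y, W y -> F (G y) = y;
  diffeo_smoothl : forall x, U x -> smooth_at F x;
  diffeo_smoothr : forall y, W y -> smooth_at G y
}.

Lemma diffeo_comp (M N P : chartedType R) {sM : smooth_space M}
    {sN : smooth_space N} {sP : smooth_space P} U W F G U' W' F' G' :
  @diffeo_on M N U W F G -> @diffeo_on N P U' W' F' G' ->
  diffeo_on (U `&` F @^-1` U') (W' `&` G' @^-1` W) (F' \o F) (G \o G').
Proof.
move=> [oU oW FW GU FK GK sF sG] [oU' oW' FW' GU' FK' GK' sF' sG']; split=> /=.
- by apply: open_setI_preimage => // x Ux; apply: smooth_at_continuous; exact: sF.
- by apply: open_setI_preimage => // y Wy; apply: smooth_at_continuous; exact: sG'.
- by move=> x [Ux U'x]; split; [exact: FW'|rewrite /= FK' //; exact: FW].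
- by move=> y [Wy W'y]; split; [exact: GU|rewrite /= GK //; exact: GU'].
- by move=> x [Ux U'x]; rewrite FK' // FK.
- by move=> y [Wy W'y]; rewrite GK // GK'.
- by move=> x [Ux U'x]; apply: smooth_at_comp; [exact: sF|exact: sF'].
- by move=> y [Wy W'y]; apply: smooth_at_comp; [exact: sG'|exact: sG].
Qed.

Lemma smooth_at_prod (M N M' N' : chartedType R) {sM : smooth_space M}
    {sN : smooth_space N} {sM' : smooth_space M'} {sN' : smooth_space N'}
    (f : M -> M') (h : N -> N') z :
  smooth_at f z.1 -> smooth_at h z.2 -> smooth_at (fun z => (f z.1, h z.2)) z.
Proof.
move=> sf sh; apply: smooth_at_pair.
  by apply: (@smooth_at_comp _ _ _ _ _ _ _ fst f) sf; exact: smooth_at_fst.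
by apply: (@smooth_at_comp _ _ _ _ _ _ _ snd h) sh; exact: smooth_at_snd.
Qed.

Lemma open_setX (X Y : topologicalType) (U : set X) (V : set Y) :
  open U -> open V -> open (U `*` V).
Proof.
move=> oU oV; rewrite openE => -[x y] [/= Ux Vy].
by exists (U, V) => //=; split; exact: open_nbhs_nbhs.
Qed.

Lemma diffeo_prod (M N M' N' : chartedType R) {sM : smooth_space M}
    {sN : smooth_space N} {sM' : smooth_space M'} {sN' : smooth_space N'}
    U W F G U' W' F' G' :
  @diffeo_on M N U W F G -> @diffeo_on M' N' U' W' F' G' ->
  @diffeo_on (M * M')%type (N * N')%type (U `*` U') (W `*` W')
    (fun z => (F z.1, F' z.2)) (fun z => (G z.1, G' z.2)).
Proof.
move=> [oU oW FW GU FK GK sF sG] [oU' oW' FW' GU' FK' GK' sF' sG']; split.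
- exact: open_setX.
- exact: open_setX.
- by move=> z [/= Uz U'z]; split; [exact: FW|exact: FW'].
- by move=> z [/= Uz U'z]; split; [exact: GU|exact: GU'].
- by move=> [x y] [/= Uz U'z]; rewrite FK// FK'.
- by move=> [x y] [/= Uz U'z]; rewrite GK// GK'.
- by move=> z [/= Uz U'z]; apply: smooth_at_prod; [exact: sF|exact: sF'].
- by move=> z [/= Uz U'z]; apply: smooth_at_prod; [exact: sG|exact: sG'].
Qed.

Lemma diffeo_id (M : chartedType R) {sM : smooth_space M} :
  @diffeo_on M M setT setT id id.
Proof. by split=> // *; try exact: openT; exact: smooth_at_id. Qed.

(** The inverse of the chart [c] on its image; [x0] is a dummy value. *)
Definition chart_inv (M : chartedType R) (c : chart R M) (x0 : M) v : M :=
  xget x0 [set x | cdom c x /\ cmap c x = v].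

Arguments chart_inv {M} c x0 v.

Lemma chart_invK (M : chartedType R) (c : chart R M) x0 x :
  is_chart c -> cdom c x -> chart_inv c x0 (cmap c x) = x.
Proof.
move=> [_ ci _ _] cx; rewrite /chart_inv; case: xgetP => [y _ [cy yE]|/(_ x)].
  by apply: ci; rewrite ?inE.
by case; split.
Qed.

Lemma smooth_at_cmap (M : chartedType R) {sM : smooth_space M} (c : chart R M) x :
  max_chart c -> cdom c x -> smooth_at (cmap c) x.
Proof.
move=> mc cx; have [[oc _ _ _] _] := mc.
apply: (@smooth_at_of_rep _ _ _ c (@Chart R 'rV[R]_(cdim c) _ setT id) _ _ id) => //.
  by apply: atlas_max.
split=> //=; first exact: smooth_near_id.
by have F := @nbhs_filter _ x; apply: filterE.
Qed.

Lemma chart_diffeo (M : chartedType R) {sM : smooth_space M} (c : chart R M) x0 :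
  max_chart c ->
  diffeo_on (cdom c) (cmap c @` cdom c) (cmap c) (chart_inv c x0).
Proof.
move=> mc; have [chc _] := mc; have [oc ci cc co] := chc.
have oI : open (cmap c @` cdom c) by exact: co.
split.
- exact: oc.
- exact: oI.
- by move=> x cx; exists x.
- by move=> _ [x cx <-]; rewrite chart_invK.
- by move=> x cx; rewrite chart_invK.
- by move=> _ [x cx <-]; rewrite chart_invK.
- by move=> x; exact: smooth_at_cmap.
move=> _ [x cx <-].
apply: (@smooth_at_of_rep _ _ _ (@Chart R 'rV[R]_(cdim c) _ setT id) c _ _ id) => //.
  by apply: atlas_max.
split=> //=; first by rewrite chart_invK.
  exact: smooth_near_id.
have nI : nbhs (cmap c x) (cmap c @` cdom c) by apply: open_nbhs_nbhs; split=> //; exists x.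
by apply: filterS nI => _ [y cy <-]; rewrite chart_invK.
Qed.

(** New charts are obtained from diffeomorphisms with an explicit inverse, without
    recourse to the inverse function theorem. *)
Lemma diffeo_max_chart (M : chartedType R) {sM : smooth_space M} n (U : set M)
    (W : set 'rV[R]_n) phi psi :
  diffeo_on U W phi psi -> max_chart (@Chart R M n U phi).
Proof.
move=> [oU oW FW GU FK GK sF sG].
have cF x : U x -> {for x, continuous phi}.
  by move=> Ux; apply: smooth_at_continuous; exact: sF.
split.
  split=> //=.
    by move=> x y /set_mem Ux /set_mem Uy e; rewrite -(FK x)// -(FK y)// e.
  move=> V oV VU.
  have -> : phi @` V = W `&` psi @^-1` V.
    apply/seteqP; split=> [_ [x Vx <-]|v [Wv Vv]].
      by split; [exact/FW/VU|rewrite /= FK//; exact: VU].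
    by exists (psi v) => //; exact: GK.
  by apply: open_setI_preimage => // y Wy; apply: smooth_at_continuous; exact: sG.
move=> d ad x /= Ux dx.
pose I := @Chart R 'rV[R]_n n setT id.
have mI : max_chart I by exact: atlas_max.
have nU : nbhs x U by exact: open_nbhs_nbhs.
have nd : nbhs x (cdom d) by have [od _ _ _] := ss_chart sM ad; exact: open_nbhs_nbhs.
split.
  have [||g [_ _ sg ng]] := smooth_at_rep _ _ mI (atlas_max sM ad) _ _ (sG _ (FW _ Ux)).
    by [].
    by rewrite FK.
  exists g; split=> //; have ng' := cF x Ux _ ng; rewrite nbhs_simpl in ng'.
  by apply: filterS2 nU ng' => y Uy /=; rewrite FK.
have [//|//|g [_ _ sg ng]] := smooth_at_rep _ _ (atlas_max sM ad) mI _ _ (sF _ Ux).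
by exists g; split=> //; apply: filterS2 nU ng => y Uy [].
Qed.

End Diffeos.
Arguments chart_inv {R M} c x0 v.

(** * Slices *)

Section Slices.
Context {R : realType}.

(** [A] is an [n]-dimensional embedded submanifold near [a]: the maximal atlas has a
    chart at [a] in which [A] is cut out by the vanishing of the last [l]
    coordinates. *)
Definition slice_at (M : chartedType R) (A : set M) (a : M) (n : nat) : Prop :=
  exists l (U : set M) (phi : M -> 'rV[R]_(n + l)),
    [/\ max_chart (@Chart R M (n + l) U phi), U a &
        forall x, U x -> (A x <-> rsubmx (phi x) = 0)].

Lemma slice_diffeo (M N : chartedType R) {sM : smooth_space M}
    {sN : smooth_space N} U W F G (A : set M) (A' : set N) a n :
  @diffeo_on R M N U W F G -> U a -> (forall x, U x -> (A x <-> A' (F x))) ->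
  slice_at A' (F a) n -> slice_at A a n.
Proof.
move=> dF Ua AA [l [V [phi [mc Va Aphi]]]].
pose proof (chart_diffeo (F a) mc) as dc.
pose proof (diffeo_max_chart (diffeo_comp dF dc)) as mc'.
exists l, (U `&` F @^-1` V), (phi \o F); split=> //.
by move=> x [Ux Vx]; rewrite AA// Aphi.
Qed.

(** The regrouping of coordinates for graphs: the additional coordinates join the
    [l] slice coordinates. *)
Lemma diffeo_assoc n l d :
  @diffeo_on R ('rV[R]_(n + l) * 'rV[R]_d)%type 'rV[R]_(n + (l + d)) setT setT
    (fun z => row_mx (lsubmx z.1) (row_mx (rsubmx z.1) z.2))
    (fun v => (row_mx (lsubmx v) (lsubmx (rsubmx v)), rsubmx (rsubmx v))).
Proof.
split=> //; try exact: openT.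
- by move=> [v w] _ /=; rewrite !(row_mxKl, row_mxKr) hsubmxK.
- by move=> v _ /=; rewrite !(row_mxKl, row_mxKr) !hsubmxK.
- move=> z _; have s1 : smooth_at fst z by exact: smooth_at_fst.
  have s2 : smooth_at snd z by exact: smooth_at_snd.
  apply: smooth_at_row_mx; first exact: smooth_at_linear_comp.
  by apply: smooth_at_row_mx => //; exact: smooth_at_linear_comp.
- move=> v _; have sl := smooth_at_linear lsubmx v.
  have sr := smooth_at_linear rsubmx v.
  apply: smooth_at_pair; last exact: smooth_at_linear_comp.
  by apply: smooth_at_row_mx => //; exact: smooth_at_linear_comp.
Qed.

(** The regrouping of coordinates for products: the additional coordinates join
    the [n] free ones. *)
Lemma diffeo_assoc_mid n l d :
  @diffeo_on R ('rV[R]_(n + l) * 'rV[R]_d)%type 'rV[R]_((n + d) + l) setT setT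
    (fun z => row_mx (row_mx (lsubmx z.1) z.2) (rsubmx z.1))
    (fun v => (row_mx (lsubmx (lsubmx v)) (rsubmx v), rsubmx (lsubmx v))).
Proof.
split=> //; try exact: openT.
- by move=> [v w] _ /=; rewrite !(row_mxKl, row_mxKr) hsubmxK.
- by move=> v _ /=; rewrite !(row_mxKl, row_mxKr) !hsubmxK.
- move=> z _; have s1 : smooth_at fst z by exact: smooth_at_fst.
  have s2 : smooth_at snd z by exact: smooth_at_snd.
  apply: smooth_at_row_mx; last exact: smooth_at_linear_comp.
  by apply: smooth_at_row_mx => //; exact: smooth_at_linear_comp.
- move=> v _; have sl := smooth_at_linear lsubmx v.
  have sr := smooth_at_linear rsubmx v.
  apply: smooth_at_pair; last exact: smooth_at_linear_comp.
  by apply: smooth_at_row_mx => //; exact: smooth_at_linear_comp.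
Qed.

(** The slice charts of the whole space have no last coordinates at all. *)
Lemma slice_setT (M : chartedType R) {sM : smooth_space M} (c : chart R M) a :
  max_chart c -> cdom c a -> slice_at setT a (cdim c).
Proof.
move=> mc ca; pose proof (chart_diffeo a mc) as dc.
have d0 : @diffeo_on R 'rV[R]_(cdim c) 'rV[R]_(cdim c + 0) setT setT
    (fun v => row_mx v 0) lsubmx.
  split=> //; try exact: openT.
  - by move=> v _; rewrite row_mxKl.
  - by move=> v _; rewrite -{2}(hsubmxK v) (thinmx0 (rsubmx v)).
  - by move=> v _; apply: smooth_at_row_mx; [exact: smooth_at_id|exact: smooth_at_cst].
  - by move=> v _; exact: smooth_at_linear.
have mc' := diffeo_max_chart (diffeo_comp dc d0).
exists 0%N; eexists; eexists; split; [exact: mc'|by []|].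
by move=> x _; split=> // _; exact: thinmx0.
Qed.

(** The additional coordinates are put among the first ones, which are those left
    free by the slice condition. *)
Lemma slice_prod (M N : chartedType R) {sM : smooth_space M}
    {sN : smooth_space N} (A : set M) a n (d : chart R N) b :
  slice_at A a n -> max_chart d -> cdom d b ->
  slice_at [set z : M * N | A z.1] (a, b) (n + cdim d).
Proof.
move=> [l [V [phi [mc Va Aphi]]]] md db.
pose proof (chart_diffeo a mc) as dc. pose proof (chart_diffeo b md) as dd.
have mc' := diffeo_max_chart (diffeo_comp (diffeo_prod dc dd)
  (diffeo_assoc_mid n l (cdim d))).
exists l; eexists; eexists; split; [exact: mc'|by []|].
by move=> [x y] [[/= Vx dy] _]; rewrite /= row_mxKr; exact: Aphi.
Qed.

(** Subtracting the value of [f], read in a chart of [P], from the second component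
    straightens the graph of [f]. *)
Lemma graph_diffeo (M P : chartedType R) {sM : smooth_space M}
    {sP : smooth_space P} (f : M -> P) (U : set M) (d : chart R P) p0 :
  open U -> (forall x, U x -> smooth_at f x) -> max_chart d ->
  @diffeo_on R (M * P)%type (M * 'rV[R]_(cdim d))%type
    [set z | (U z.1 /\ cdom d (f z.1)) /\ cdom d z.2]
    [set w | (U w.1 /\ cdom d (f w.1)) /\
       (cmap d @` cdom d) (w.2 + cmap d (f w.1))]
    (fun z => (z.1, cmap d z.2 - cmap d (f z.1)))
    (fun w => (w.1, chart_inv d p0 (w.2 + cmap d (f w.1)))).
Proof.
move=> oU sf md; case: (chart_diffeo p0 md) => od oI dF dG FK GK sF sG.
have [[_ _ cd _] _] := md.
have oUd : open (U `&` f @^-1` cdom d).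
  by apply: open_setI_preimage => // x Ux; apply: smooth_at_continuous; exact: sf.
have s1 z : smooth_at (fst : M * P -> M) z by exact: smooth_at_fst.
have t1 z : smooth_at (fst : M * 'rV[R]_(cdim d) -> M) z by exact: smooth_at_fst.
have t2 z : smooth_at (snd : M * 'rV[R]_(cdim d) -> _) z by exact: smooth_at_snd.
have sdf x : U x -> cdom d (f x) -> smooth_at (fun y => cmap d (f y)) x.
  by move=> Ux dfx; apply: smooth_at_comp; [exact: sf|exact: sF].
have ssum w : U w.1 -> cdom d (f w.1) ->
    smooth_at (fun w : M * 'rV[R]_(cdim d) => w.2 + cmap d (f w.1)) w.
  move=> Uw dw; apply: smooth_at_add => //.
  by apply: (@smooth_at_comp _ _ _ _ _ _ _ fst (fun y => cmap d (f y))) => //; exact: sdf.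
split.
- exact: (@open_setX _ _ (U `&` f @^-1` cdom d) (cdom d)).
- pose T := (U `&` f @^-1` cdom d) `*` [set: 'rV[R]_(cdim d)].
  have oT : open T by apply: open_setX => //; exact: openT.
  have oTI : open (T `&` (fun w => w.2 + cmap d (f w.1)) @^-1` (cmap d @` cdom d)).
    apply: open_setI_preimage; [exact: oT| |exact: oI] => w [[Uw dw] _].
    by apply: smooth_at_continuous; exact: ssum.
  by congr open: oTI; apply/seteqP; split=> [w [[]]|w []] //; split.
- by move=> z [Uz dz]; split=> //=; exists z.2 => //; rewrite subrK.
- by move=> w [Uw dw]; split=> //=; exact: dG.
- by move=> [x p] [/= Uz dz]; rewrite subrK FK.
- by move=> [x v] [/= Uw dw]; rewrite GK// addrK.
- move=> z [[Uz dfz] dz]; apply: smooth_at_pair => //; apply: smooth_at_sub.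
    by apply: (@smooth_at_comp _ _ _ _ _ _ _ snd (cmap d)); [exact: smooth_at_snd|exact: sF].
  by apply: (@smooth_at_comp _ _ _ _ _ _ _ fst (fun y => cmap d (f y))) => //; exact: sdf.
- move=> w [[Uw dfw] dw]; apply: smooth_at_pair => //.
  apply: (@smooth_at_comp _ _ _ _ _ _ _ _ (chart_inv d p0)); first exact: ssum.
  exact: sG.
Qed.

(** Once the graph of [f] is straightened, the conditions [z.2 = f z.1] and
    [A z.1] are the vanishing of two groups of coordinates. This lemma is the
    substitute for the implicit function theorem: in suitable
    coordinates, the fibre products studied below are graphs over slices that are
    already known. *)
Lemma slice_graph (M P : chartedType R) {sM : smooth_space M}
    {sP : smooth_space P} (A : set M) (f : M -> P) a n (U : set M) :
  open U -> U a -> (forall x, U x -> smooth_at f x) -> slice_at A a n ->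
  slice_at [set z : M * P | A z.1 /\ z.2 = f z.1] (a, f a) n.
Proof.
move=> oU Ua sf [l [V [phi [mc Va Aphi]]]].
have [d ad dfa] := ss_cover sP (f a); have md := atlas_max sP ad.
pose proof (chart_diffeo a mc) as dc.
pose proof (graph_diffeo (f a) oU sf md) as dg.
pose proof (diffeo_prod dc (@diffeo_id R 'rV[R]_(cdim d) _)) as dd.
have mc' := diffeo_max_chart (diffeo_comp (diffeo_comp dg dd)
  (diffeo_assoc n l (cdim d))).
exists (l + cdim d)%N; eexists; eexists; split; [exact: mc'|by []|].
move=> [x y] [[[[/= Ux dfx] dy] [/= Vx _]] _]; rewrite /= row_mxKr.
split=> [[/Aphi -> // ->]|/eqP]; first by rewrite subrr row_mx0.
rewrite -(row_mx0 R 1 l (cdim d)) => /eqP/eq_row_mx [/(Aphi _ Vx) Ax /eqP].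
rewrite subr_eq0 => /eqP e; split=> //.
by have [[_ di _ _] _] := md; apply: di; rewrite ?inE.
Qed.

End Slices.

(** * Embedded subsets *)

Section Subsets.
Context {R : realType} {M : chartedType R} {sM : smooth_space M}.

Lemma max_compatible (c d : chart R M) : max_chart c -> max_chart d -> compatible c d.
Proof.
move=> mc md x cx dx.
have sid : smooth_at (id : M -> M) x by exact: smooth_at_id.
by split; [exact: smooth_at_rep cx dx sid|exact: smooth_at_rep dx cx sid].
Qed.

Variable A : set M.

Lemma val_continuous : continuous (val : set_type A -> M).
Proof. exact: initial_continuous. Qed.

Section SubChart.
Variables (n l : nat) (U : set M) (phi : M -> 'rV[R]_(n + l)).
Hypothesis mc : max_chart (@Chart R M (n + l) U phi).
Hypothesis Aphi : forall x, U x -> (A x <-> rsubmx (phi x) = 0).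

Definition sub_chart : chart R (set_type A) :=
  @Chart R (set_type A) n (fun x => U (val x)) (fun x => lsubmx (phi (val x))).

Lemma sub_chartK (x : set_type A) :
  U (val x) -> row_mx (lsubmx (phi (val x))) 0 = phi (val x).
Proof.
by move=> Ux; rewrite -((Aphi Ux).1 (set_mem (valP x))) hsubmxK.
Qed.

Lemma sub_is_chart : is_chart sub_chart.
Proof.
have [[oU iU cU co] _] := mc; split=> /=.
- exact: ((continuousP _).1 val_continuous U oU).
- move=> x y; rewrite !inE => Ux Uy e; apply: val_inj; apply: iU; rewrite ?inE//=.
  by rewrite -(sub_chartK Ux) e sub_chartK.
- move=> x Ux; have c1 := continuous_comp (@val_continuous x) (cU _ Ux).
  exact: continuous_comp c1 (@continuous_linear R _ _ lsubmx _).
move=> V [B oB <-] BU.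
have oI : open (phi @` (B `&` U)) by apply: co; [exact: openI|move=> x []].
pose L : {linear 'rV[R]_n -> 'rV[R]_(n + l)} := mulmxr (row_mx 1%:M 0).
have LE v : L v = row_mx v 0 by rewrite /= mul_mx_row mulmx1 mulmx0.
have := (continuousP _).1 (@continuous_linear R _ _ L) _ oI.
congr open; apply/seteqP; split=> [v [x [Bx Ux]]|_ [x Bx <-]]; last first.
  by exists (val x); [split=> //; exact: (BU x)|rewrite LE sub_chartK//; exact: (BU x)].
rewrite LE => e; have Ax : A x by apply/(Aphi Ux); rewrite e row_mxKr.
by exists (exist _ x (mem_set Ax)) => //=; rewrite e row_mxKl.
Qed.

Lemma sub_chart_atlas : (atlas : set (chart R (set_type A))) sub_chart.
Proof. by case: mc => c1 c2; exists n, l, U, phi. Qed.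

End SubChart.

Lemma sub_atlasP (e : chart R (set_type A)) : atlas e ->
  exists n l (U : set M) (phi : M -> 'rV[R]_(n + l)),
  [/\ max_chart (@Chart R M (n + l) U phi),
      forall x, U x -> (A x <-> rsubmx (phi x) = 0) & e = sub_chart U phi].
Proof. by move=> [n [l [U [phi [? ? ? ->]]]]]; exists n, l, U, phi. Qed.

(** On [A] the last coordinates of a slice chart vanish, so that a transition [g]
    of the ambient charts induces the transition
    [v |-> lsubmx (g (row_mx v 0))] of their restrictions. *)
Lemma sub_smooth_space :
  (forall x, A x -> exists n, slice_at A x n) -> smooth_space (set_type A).
Proof.
move=> cov; split.
- move=> x; have [n [l [U [phi [mc Ux Aphi]]]]] := cov _ (set_mem (valP x)).
  by exists (sub_chart U phi) => //; exact: sub_chart_atlas.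
- by move=> e /sub_atlasP [n [l [U [phi [mc Aphi ->]]]]]; exact: sub_is_chart.
have key n l U (phi : M -> 'rV[R]_(n + l)) n' l' U' (phi' : M -> 'rV[R]_(n' + l'))
   x : max_chart (@Chart R M _ U phi) -> max_chart (@Chart R M _ U' phi') ->
   (forall x, U x -> (A x <-> rsubmx (phi x) = 0)) ->
   cdom (sub_chart U phi) x -> cdom (sub_chart U' phi') x ->
   exists g, local_rep (sub_chart U phi) (sub_chart U' phi') id x g.
  move=> mc mc' Aphi /= Ux U'x.
  have [[g [_ _ sg ng]] _] := max_compatible mc mc' Ux U'x.
  exists (fun v => lsubmx (g (row_mx v 0))); split=> //=.
    apply: (@smooth_near_comp _ _ _ _ _ lsubmx); last exact: smooth_near_linear.
    apply: (@smooth_near_comp _ _ _ _ (fun v => row_mx v 0) g).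
      by apply: smooth_near_row_mx; [exact: smooth_near_id|exact: smooth_near_cst].
    by rewrite /= (sub_chartK Aphi Ux).
  have nU : nbhs x (fun y : set_type A => U (val y)).
    by have [oU _ _ _] := sub_is_chart mc Aphi; exact: open_nbhs_nbhs.
  have ng' := @val_continuous x _ ng; rewrite nbhs_simpl in ng'.
  by apply: filterS2 nU ng' => y Uy [/= ? e]; rewrite (sub_chartK Aphi Uy) -e.
move=> e e' /sub_atlasP [n [l [U [phi [mc Aphi ->]]]]].
move=> /sub_atlasP [n' [l' [U' [phi' [mc' Aphi' ->]]]]] x Ux U'x.
by split; exact: key.
Qed.

Lemma smooth_at_val (x : set_type A) {sA : smooth_space (set_type A)} :
  smooth_at (val : set_type A -> M) x.
Proof.
have [e ae ex] := ss_cover sA x.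
have me := atlas_max sA ae; move: me ex.
have [n [l [U [phi [mc Aphi ->]]]]] := sub_atlasP ae => me /= Ux.
apply: (@smooth_at_of_rep _ _ _ (sub_chart U phi) (@Chart R M (n + l) U phi) _ _
  (fun v => row_mx v 0) sA sM me mc).
split=> //=; first by apply: smooth_near_row_mx; [exact: smooth_near_id|exact: smooth_near_cst].
have nU : nbhs x (fun y : set_type A => U (val y)).
  by have [oU _ _ _] := sub_is_chart mc Aphi; exact: open_nbhs_nbhs.
by apply: filterS nU => y Uy; rewrite (sub_chartK Aphi Uy).
Qed.

(** In a slice chart, a map into [A] is given by some of the coordinates of the
    same map seen in [M]. *)
Lemma smooth_at_sub_of_val (L : chartedType R) {sL : smooth_space L}
    {sA : smooth_space (set_type A)} (f : L -> set_type A) x :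
  smooth_at (fun y => val (f y)) x -> smooth_at f x.
Proof.
move=> sf; have [e ae ex] := ss_cover sA (f x).
have me := atlas_max sA ae; move: me ex.
have [n [l [U [phi [mc Aphi ->]]]]] := sub_atlasP ae => me /= Ux.
have [c ac cx] := ss_cover sL x; have mcL := atlas_max sL ac.
have [g [_ _ sg ng]] := smooth_at_rep sL sM mcL mc cx Ux sf.
apply: (@smooth_at_of_rep _ _ _ c (sub_chart U phi) _ _
  (fun v => lsubmx (g v)) sL sA mcL me).
split=> //=.
  by apply: (@smooth_near_comp _ _ _ _ g lsubmx) => //; exact: smooth_near_linear.
by apply: filterS ng => y [/= Uy ->].
Qed.

End Subsets.

(** * Manifolds and submersions *)

Section Differentials.
Context {R : realType}.

Lemma diff_row_mx n m p (f : 'rV[R]_n -> 'rV[R]_m) (g : 'rV[R]_n -> 'rV[R]_p) x v :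
  differentiable f x -> differentiable g x ->
  'd (fun y => row_mx (f y) (g y)) x v = row_mx ('d f x v) ('d g x v).
Proof.
move=> df dg.
pose L1 : {linear 'rV[R]_m -> 'rV[R]_(m + p)} := mulmxr (row_mx 1%:M 0).
pose L2 : {linear 'rV[R]_p -> 'rV[R]_(m + p)} := mulmxr (row_mx 0 1%:M).
have E a b : row_mx a b = L1 a + L2 b by exact: row_mx_linear.
have -> : (fun y => row_mx (f y) (g y)) = (L1 \o f) + (L2 \o g).
  by apply/funext => y; rewrite E.
have dL1 y : differentiable L1 y by apply: linear_differentiable; exact: continuous_linear.
have dL2 y : differentiable L2 y by apply: linear_differentiable; exact: continuous_linear.
have d1 := differentiable_comp df (dL1 (f x)).
have d2 := differentiable_comp dg (dL2 (g x)).
have eD := congr1 (@^~ v) (diffD d1 d2).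
have e1 := congr1 (@^~ v) (diff_comp df (dL1 (f x))).
have e2 := congr1 (@^~ v) (diff_comp dg (dL2 (g x))).
have l1 := congr1 (@^~ ('d f x v)) (diff_lin (f x) (@continuous_linear R _ _ L1)).
have l2 := congr1 (@^~ ('d g x v)) (diff_lin (g x) (@continuous_linear R _ _ L2)).
rewrite /= in eD e1 e2 l1 l2.
exact: etrans eD (etrans (congr2 +%R (etrans e1 l1) (etrans e2 l2)) (esym (E _ _))).
Qed.

Lemma diff_comp_at n m p (f : 'rV[R]_n -> 'rV[R]_m) (g : 'rV[R]_m -> 'rV[R]_p) x y v :
  f x = y -> differentiable f x -> differentiable g y ->
  'd (g \o f) x v = 'd g y ('d f x v).
Proof. by move=> <- df dg; have e := congr1 (@^~ v) (diff_comp df dg); exact: e. Qed.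

Lemma diff_linear n m (L : {linear 'rV[R]_n -> 'rV[R]_m}) x v : 'd L x v = L v.
Proof.
by have e := congr1 (@^~ v) (diff_lin x (@continuous_linear R _ _ L)); exact: e.
Qed.

Lemma diff_idE n (x v : 'rV[R]_n) : 'd (@id 'rV[R]_n) x v = v.
Proof.
by have e := congr1 (@^~ v) (@diff_val _ _ _ _ _ _ _ (is_diff_id x)); exact: e.
Qed.

Lemma diff_near_eq n m (f g : 'rV[R]_n -> 'rV[R]_m) x v :
  differentiable f x -> (\forall y \near x, f y = g y) -> 'd f x v = 'd g x v.
Proof.
move=> df fg; have dg := near_eq_differentiable fg df.
exact: etrans (esym (deriveE v df)) (etrans (near_eq_derive v fg) (deriveE v dg)).
Qed.

(** A function that is the identity near a point has the identity for
    differential. *)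
Lemma diff_cancel n m (g : 'rV[R]_n -> 'rV[R]_m) (h : 'rV[R]_m -> 'rV[R]_n) x v :
  differentiable g x -> differentiable h (g x) ->
  (\forall y \near x, h (g y) = y) -> 'd h (g x) ('d g x v) = v.
Proof.
move=> dg dh hg; have dhg : differentiable (h \o g) x by exact: differentiable_comp.
have e1 := congr1 (@^~ v) (diff_comp dg dh).
have e2 := congr1 (@^~ v) (@diff_val _ _ _ _ _ _ _ (is_diff_id x)).
exact: etrans (esym e1) (etrans (diff_near_eq v dhg hg) e2).
Qed.

Lemma linear_cancel_dim n m (f : {linear 'rV[R]_n -> 'rV[R]_m})
    (h : {linear 'rV[R]_m -> 'rV[R]_n}) : cancel f h -> (n <= m)%N.
Proof.
move=> fh; apply: (@mulmx1_min R n m (lin1_mx f) (lin1_mx h)).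
by apply/row_matrixP => i; rewrite !rowE mulmxA !mul_rV_lin1 fh mulmx1.
Qed.

End Differentials.

Section Manifolds.
Context {R : realType}.

Lemma transition_diff (M : chartedType R) (c d : chart R M) x g h :
  is_chart c -> is_chart d ->
  local_rep c d id x g -> local_rep d c id x h ->
  cancel ('d g (cmap c x)) ('d h (cmap d x)).
Proof.
move=> chc chd rg rh v; have gE := local_rep_value rg.
rewrite /= in gE; rewrite gE; have [_ _ sg _] := rg; have [_ _ sh _] := rh.
rewrite gE in sh; apply: diff_cancel; try exact: smooth_near_differentiable.
have [cx _ _ _] := rg.
apply: local_rep_unique (local_rep_id chc cx) => //.
exact: (local_rep_comp (f := id) (h := id) chc chd rg rh).
Qed.

(** The differentials of the two transitions are mutually inverse linear maps. *)
Lemma max_chart_cdim (M : chartedType R) {sM : smooth_space M} (c d : chart R M) x :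
  max_chart c -> max_chart d -> cdom c x -> cdom d x -> cdim c = cdim d.
Proof.
move=> mc md cx dx; have [[g rg] [h rh]] := max_compatible mc md cx dx.
have [[chc _] [chd _]] := (mc, md).
apply/eqP; rewrite eqn_leq; apply/andP; split.
  exact: linear_cancel_dim (transition_diff chc chd rg rh).
exact: linear_cancel_dim (transition_diff chd chc rh rg).
Qed.

Lemma cluster_image (X Y : topologicalType) (f : X -> Y) p q :
  {for p, continuous f} -> {for q, continuous f} ->
  cluster (nbhs p) q -> cluster (nbhs (f p)) (f q).
Proof.
move=> cp cq pq A B nA nB; have [x [Ax Bx]] := pq _ _ (cp _ nA) (cq _ nB).
by exists (f x).
Qed.

Lemma hausdorff_prod (X Y : topologicalType) :
  hausdorff_space X -> hausdorff_space Y -> hausdorff_space (X * Y)%type.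
Proof.
move=> hX hY [x y] [x' y'] c; congr (_, _).
  by apply: hX; apply: (@cluster_image _ _ fst) c; exact: cvg_fst.
by apply: hY; apply: (@cluster_image _ _ snd) c; exact: cvg_snd.
Qed.

Lemma second_countable_prod (X Y : topologicalType) :
  @second_countable X -> @second_countable Y -> @second_countable (X * Y)%type.
Proof.
move=> [B cB [oB bB]] [C cC [oC bC]].
exists ((fun UV => UV.1 `*` UV.2) @` (B `*` C)).
  exact: sub_countable (card_image_le _ _) (countableX cB cC).
split=> [_ [[U V] [/= BU CV] <-]|[x y] W [[P Q] [/= nP nQ] PQW]].
  by apply: open_setX; [exact: oB|exact: oC].
have [U [BU Ux] UP] := bB x _ nP; have [V [CV Vy] VQ] := bC y _ nQ.
exists (U `*` V); first by split=> //; exists (U, V).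
by move=> z [Uz Vz]; apply: PQW; split; [exact: UP|exact: VQ].
Qed.

Lemma second_countable_sub (X : topologicalType) (A : set X) :
  @second_countable X -> @second_countable (set_type A).
Proof.
move=> [B cB [oB bB]]; exists ((fun U => val @^-1` U) @` B).
  exact: sub_countable (card_image_le _ _) cB.
split=> [_ [U BU <-]|x].
  by exists U => //; exact: oB.
move=> V [_ [[W oW <-]] /= Wx WV].
have [U [BU Ux] UW] := bB _ _ (open_nbhs_nbhs (conj oW Wx)).
exists (val @^-1` U); first by split=> //; exists U.
by move=> y /= Uy; apply: WV; exact: UW.
Qed.

Lemma manifold_prod (M N : chartedType R) :
  manifold M -> manifold N -> manifold (M * N)%type.
Proof.
move=> mM mN; have sM := manifold_smooth_space mM; have sN := manifold_smooth_space mN.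
have sMN : smooth_space (M * N)%type by exact: smooth_space_prod.
split; [ | |exact: ss_cover|exact: ss_chart|exact: ss_compat|].
- by apply: hausdorff_prod; [case: mM|case: mN].
- by apply: second_countable_prod; [case: mM|case: mN].
have [n Hn] := manifold_dim mM; have [m Hm] := manifold_dim mN; exists (n + m)%N.
move=> _ [c [d [ac ad ->]]] [[x y] [/= cx dy]].
by rewrite (Hn c)// ?(Hm d)//; [exists y|exists x].
Qed.

(** A slice chart of dimension [n] through each point fixes the dimension of every
    other chart of [A] through this point. *)
Lemma manifold_sub (M : chartedType R) (A : set M) n :
  manifold M -> (forall x, A x -> slice_at A x n) -> manifold (set_type A).
Proof.
move=> mM sl; have sM := manifold_smooth_space mM.
have sA : smooth_space (set_type A) by apply: sub_smooth_space => x Ax; exists n; exact: sl.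
split; [ | |exact: ss_cover|exact: ss_chart|exact: ss_compat|].
- move=> x y xy; apply: val_inj; apply: (manifold_hausdorff mM).
  exact: cluster_image (@val_continuous _ _ _ x) (@val_continuous _ _ _ y) xy.
- exact: second_countable_sub (manifold_countable mM).
exists n => e ae [x ex].
have [l [U [phi [mc Ux Aphi]]]] := sl _ (set_mem (valP x)).
have a' := sub_chart_atlas mc Aphi.
exact: max_chart_cdim (atlas_max sA ae) (atlas_max sA a') ex Ux.
Qed.

End Manifolds.

Section Submersions.
Context {R : realType}.

(** Local version of [submersion], which is needed because parametrizations are
    only defined locally. *)
Definition submersion_at (M N : chartedType R) (f : M -> N) x :=
  exists c d g, [/\ atlas c, atlas d, local_rep c d f x g &
        forall w, exists v, 'd g (cmap c x) v = w].

(** The differentials of two local representatives differ by those of transitions,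
    which are invertible. *)
Lemma submersion_at_rep (M N : chartedType R) {sM : smooth_space M}
    {sN : smooth_space N} (f : M -> N) x (c : chart R M) (d : chart R N) g :
  submersion_at f x -> max_chart c -> max_chart d -> local_rep c d f x g ->
  forall w, exists v, 'd g (cmap c x) v = w.
Proof.
move=> [c' [d' [g' [ac' ad' rg' sg']]]] mc md rg w.
have mc' := atlas_max sM ac'; have md' := atlas_max sN ad'.
have [[chc _] [chd _]] := (mc, md); have [[chc' _] [chd' _]] := (mc', md').
have [cx dfx sg _] := rg; have [c'x d'fx sm' _] := rg'.
have [[a ra] [a' ra']] := max_compatible mc mc' cx c'x.
have [[b rb] [b' rb']] := max_compatible md' md d'fx dfx.
have [_ _ sa _] := ra; have [_ _ sb _] := rb.
have da := smooth_near_differentiable sa.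
have dg' := smooth_near_differentiable sm'.
have db := smooth_near_differentiable sb.
have aE : a (cmap c x) = cmap c' x := esym (local_rep_value ra).
have g'E : g' (cmap c' x) = cmap d' (f x) := esym (local_rep_value rg').
have E : \forall v \near cmap c x, g v = (b \o (g' \o a)) v.
  apply: local_rep_unique rg _ => //.
  have r1 := local_rep_comp (f := id) (h := f) chc chc' ra rg'.
  exact: (local_rep_comp (h := id) chc chd' r1 rb).
have [u uE] := sg' ('d b' (cmap d (f x)) w).
exists ('d a' (cmap c' x) u).
have dga : differentiable (g' \o a) (cmap c x).
  by apply: differentiable_comp => //; rewrite aE.
have gaE : (g' \o a) (cmap c x) = cmap d' (f x) by rewrite /= aE.
apply: etrans (diff_near_eq _ (smooth_near_differentiable sg) E) _.
apply: etrans (diff_comp_at _ gaE dga db) _.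
apply: etrans (congr1 _ (diff_comp_at _ aE da dg')) _.
apply: etrans (congr1 (fun v => 'd b _ ('d g' _ v)) (transition_diff chc' chc ra' ra u)) _.
exact: etrans (congr1 _ uE) (transition_diff chd chd' rb' rb w).
Qed.

Lemma submersion_at_comp (M N P : chartedType R) {sM : smooth_space M}
    {sN : smooth_space N} {sP : smooth_space P} (f : M -> N) (h : N -> P) x :
  submersion_at f x -> submersion_at h (f x) -> submersion_at (h \o f) x.
Proof.
move=> [c [d [g [ac ad rg sg]]]] sh; have [d' [e [k0 [ad' ae rk0 _]]]] := sh.
have [_ dfx smg _] := rg; have [_ ehfx _ _] := rk0.
have smh : smooth_at h (f x) by exists d', e, k0.
have [k rk] := smooth_at_rep sN sP (atlas_max sN ad) (atlas_max sP ae) dfx ehfx smh.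
exists c, e, (k \o g); split=> //.
  exact: local_rep_comp (ss_chart sM ac) (ss_chart sN ad) rg rk.
move=> w; have [u uE] := submersion_at_rep sh (atlas_max sN ad) (atlas_max sP ae) rk w.
have [v vE] := sg u; exists v.
have [_ _ smk _] := rk.
have dg := smooth_near_differentiable smg; have dk := smooth_near_differentiable smk.
exact: etrans (diff_comp_at _ (esym (local_rep_value rg)) dg dk) (etrans (congr1 _ vE) uE).
Qed.

(** The range of the differential of [h] contains that of [h \o f]. It is applied
    to a local parametrization [f], for which [h \o f] is explicit. *)
Lemma submersion_at_cancel (M N P : chartedType R) {sM : smooth_space M}
    {sN : smooth_space N} {sP : smooth_space P} (f : M -> N) (h : N -> P) x :
  smooth_at f x -> smooth_at h (f x) ->
  submersion_at (h \o f) x -> submersion_at h (f x).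
Proof.
move=> [c [d [g [ac ad rg]]]] smh shf; have [d' [e [k0 [ad' ae rk0]]]] := smh.
have [_ dfx smg _] := rg; have [_ ehfx _ _] := rk0.
have [k rk] := smooth_at_rep sN sP (atlas_max sN ad) (atlas_max sP ae) dfx ehfx smh.
exists d, e, k; split=> // w.
have rkg := local_rep_comp (ss_chart sM ac) (ss_chart sN ad) rg rk.
have [v vE] := submersion_at_rep shf (atlas_max sM ac) (atlas_max sP ae) rkg w.
exists ('d g (cmap c x) v); have [_ _ smk _] := rk.
have dk := smooth_near_differentiable smk; have dg := smooth_near_differentiable smg.
exact: etrans (esym (diff_comp_at _ (esym (local_rep_value rg)) dg dk)) vE.
Qed.

Lemma submersion_at_eq (M N : chartedType R) (f f' : M -> N) x :
  (\forall y \near x, f y = f' y) -> submersion_at f x -> submersion_at f' x.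
Proof.
move=> ff [c [d [g [ac ad rep sg]]]]; exists c, d, g; split=> //.
exact: local_rep_eq ff rep.
Qed.

Lemma submersion_at_id (M : chartedType R) {sM : smooth_space M} (x : M) :
  submersion_at id x.
Proof.
have [c ac cx] := ss_cover sM x; exists c, c, id; split=> //.
  exact: local_rep_id (ss_chart sM ac) cx.
move=> w; exists w.
exact: diff_idE.
Qed.

Lemma submersion_at_section (M N : chartedType R) {sM : smooth_space M}
    {sN : smooth_space N} (f : M -> N) (s : N -> M) y :
  smooth_at s y -> smooth_at f (s y) -> (\forall z \near y, f (s z) = z) ->
  submersion_at f (s y).
Proof.
move=> ss sf fs; apply: submersion_at_cancel => //.
apply: submersion_at_eq (submersion_at_id y).
by apply: filterS fs => z /= e; exact: esym e.
Qed.

Lemma submersion_at_prod_id (M N P : chartedType R) {sM : smooth_space M}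
    {sN : smooth_space N} {sP : smooth_space P} (f : M -> N) (z : M * P) :
  submersion_at f z.1 -> submersion_at (fun z : M * P => (f z.1, z.2)) z.
Proof.
move: z => [x y] /= [c [d [g [ac ad rg sg]]]].
have [e ae ey] := ss_cover sP y.
have rid := local_rep_id (ss_chart sP ae) ey.
have rep := local_rep_prod rg rid.
exists (prod_chart c e), (prod_chart d e), (fun v => row_mx (g (lsubmx v)) (rsubmx v)).
split=> //; first by exists c, e. 
  by exists d, e.
move=> w; have [v vE] := sg (lsubmx w); exists (row_mx v (rsubmx w)).
have [_ _ smg _] := rg; have dg := smooth_near_differentiable smg.
have dl u : differentiable (lsubmx : 'rV[R]_(cdim c + cdim e) -> _) u.
  by apply: linear_differentiable; exact: continuous_linear.
have dr u : differentiable (rsubmx : 'rV[R]_(cdim c + cdim e) -> _) u.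
  by apply: linear_differentiable; exact: continuous_linear.
have dgl : differentiable (fun v : 'rV[R]_(cdim c + cdim e) => g (lsubmx v))
    (row_mx (cmap c x) (cmap e y)).
  by apply: (@differentiable_comp _ _ _ _ lsubmx g) => //; rewrite row_mxKl.
apply: etrans (diff_row_mx _ dgl (dr _)) _; rewrite -[RHS]hsubmxK; congr row_mx.
  apply: etrans (diff_comp_at _ (row_mxKl _ _) (dl _) dg) _.
  apply: etrans (congr1 _ (diff_linear lsubmx _ _)) _.
  by rewrite /= row_mxKl.
apply: etrans (diff_linear rsubmx _ _) _.
by rewrite /= row_mxKr.
Qed.

End Submersions.

(** * Fibre products, Lie groups and the Lie 2-group of a crossed module *)

Section FibreProducts.
Context {R : realType} {M N : chartedType R} {Z : Type}.
Variables (f : M -> Z) (g : N -> Z).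

Lemma fp_eq (u v : fibprod f g) : fp1 u = fp1 v -> fp2 u = fp2 v -> u = v.
Proof.
rewrite /fp1 /fp2 => e1 e2; apply: val_inj; move: e1 e2.
by case: (val u) (val v) => [x y] [x' y'] /= -> ->.
Qed.

Lemma fp1_fpair x y e : fp1 (fpair x y e : fibprod f g) = x.
Proof. by []. Qed.

Lemma fp2_fpair x y e : fp2 (fpair x y e : fibprod f g) = y.
Proof. by []. Qed.

Lemma fpair_eq x y e x' y' e' : x = x' -> y = y' ->
  fpair x y e = fpair x' y' e' :> fibprod f g.
Proof. by move=> ex ey; apply: fp_eq. Qed.

(** A total version of [fpair]: trivializations are total functions, whereas the
    pairs formed from their values lie in the fibre product only over part of
    their domain. *)
Definition fp_insub (u0 : fibprod f g) x y : fibprod f g :=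
  if pselect (f x = g y) is left e then fpair x y e else u0.

Lemma fp1_insub u0 x y : f x = g y -> fp1 (fp_insub u0 x y) = x.
Proof. by rewrite /fp_insub; case: pselect. Qed.

Lemma fp2_insub u0 x y : f x = g y -> fp2 (fp_insub u0 x y) = y.
Proof. by rewrite /fp_insub; case: pselect. Qed.

Lemma fp_insubE u0 x y e : fp_insub u0 x y = fpair x y e.
Proof. by apply: fp_eq; rewrite ?fp1_insub ?fp2_insub. Qed.

Context {sM : smooth_space M} {sN : smooth_space N}.
Context {sF : smooth_space (fibprod f g)}.

Lemma smooth_at_fp1 (u : fibprod f g) : smooth_at fp1 u.
Proof.
have sMN := smooth_space_prod sM sN.
have sv := @smooth_at_val R (M * N)%type sMN _ u sF.
exact: (@smooth_at_comp _ _ _ _ sF sMN sM _ _ _ sv (smooth_at_fst _)).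
Qed.

Lemma smooth_at_fp2 (u : fibprod f g) : smooth_at fp2 u.
Proof.
have sMN := smooth_space_prod sM sN.
have sv := @smooth_at_val R (M * N)%type sMN _ u sF.
exact: (@smooth_at_comp _ _ _ _ sF sMN sN _ _ _ sv (smooth_at_snd _)).
Qed.

Lemma smooth_at_to_fibprod (L : chartedType R) {sL : smooth_space L}
    (h : L -> fibprod f g) x :
  smooth_at (fun y => fp1 (h y)) x -> smooth_at (fun y => fp2 (h y)) x ->
  smooth_at h x.
Proof.
move=> s1 s2; have sMN := smooth_space_prod sM sN.
apply: (@smooth_at_sub_of_val R (M * N)%type sMN
  [set z | f z.1 = g z.2] L sL sF h x).
apply: (smooth_at_ext _ (smooth_at_pair s1 s2)) => y.
by rewrite /fp1 /fp2; case: (val (h y)).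
Qed.

End FibreProducts.

Lemma lie_group_smooth_space (R : realType) (G : chartedGroupType R) :
  lie_group G -> smooth_space G.
Proof. by case=> mG _ _; exact: manifold_smooth_space. Qed.

Section LieGroupMaps.
Context {R : realType} {G : chartedGroupType R} (lG : lie_group G).
Context {M : chartedType R} {sM : smooth_space M}.

Lemma smooth_at_mulg (f h : M -> G) x :
  smooth_at f x -> smooth_at h x -> smooth_at (fun y => (f y * h y)%g) x.
Proof.
move=> sf sh; have sG := lie_group_smooth_space lG.
exact: smooth_at_comp (smooth_at_pair sf sh) (lie_group_mul lG _).
Qed.

Lemma smooth_at_invg (f : M -> G) x :
  smooth_at f x -> smooth_at (fun y => (f y)^-1%g) x.
Proof.
move=> sf; have sG := lie_group_smooth_space lG.
exact: smooth_at_comp sf (lie_group_inv lG _).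
Qed.

End LieGroupMaps.

(** Such a map is its own section. *)
Lemma submersion_involution (R : realType) (M : chartedType R)
    {sM : smooth_space M} (i : M -> M) :
  smooth i -> involutive i -> submersion i.
Proof.
move=> si ii x; rewrite -[x]ii; apply: submersion_at_section => //.
by apply: nearW => z; exact: ii.
Qed.

Section CrossedModuleMaps.
Context {R : realType} {G H : chartedGroupType R} (cm : crossed_module G H).

Lemma tau1 : tau cm 1%g = 1%g.
Proof. by apply: (@mulgI _ (tau cm 1%g)); rewrite -cm_tauM !mulg1. Qed.

Lemma tauV h : tau cm h^-1%g = (tau cm h)^-1%g.
Proof. by apply: (@mulgI _ (tau cm h)); rewrite -cm_tauM !mulgV tau1. Qed.

Lemma alphaV g h : alpha cm g h^-1%g = (alpha cm g h)^-1%g.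
Proof.
by apply: (@mulgI _ (alpha cm g h)); rewrite -cm_alphaM !mulgV alpha_one.
Qed.

Context {M : chartedType R} {sM : smooth_space M}.

Lemma smooth_at_tau (f : M -> H) x :
  smooth_at f x -> smooth_at (fun y => tau cm (f y)) x.
Proof.
move=> sf; have sG := lie_group_smooth_space (cm_lieG cm).
have sH := lie_group_smooth_space (cm_lieH cm).
exact: smooth_at_comp sf (cm_tau_smooth cm _).
Qed.

Lemma smooth_at_alpha (f : M -> G) (h : M -> H) x :
  smooth_at f x -> smooth_at h x -> smooth_at (fun y => alpha cm (f y) (h y)) x.
Proof.
move=> sf sh; have sG := lie_group_smooth_space (cm_lieG cm).
have sH := lie_group_smooth_space (cm_lieH cm).
exact: smooth_at_comp (smooth_at_pair sf sh) (cm_alpha_smooth cm _).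
Qed.

End CrossedModuleMaps.

Section TwoGroup.
Context {R : realType} {G H : chartedGroupType R} (cm : crossed_module G H).
Local Notation HG := (semidirect cm).

Let lG := cm_lieG cm.
Let lH := cm_lieH cm.
#[local] Instance smooth_space_G : smooth_space G := lie_group_smooth_space lG.
#[local] Instance smooth_space_H : smooth_space H := lie_group_smooth_space lH.

Lemma manifold_semidirect : manifold HG.
Proof.
exact: (manifold_prod (lie_group_manifold lH) (lie_group_manifold lG)).
Qed.
#[local] Instance smooth_space_HG : smooth_space HG :=
  manifold_smooth_space manifold_semidirect.

Lemma smooth_at_sd1 (x : HG) : smooth_at (fun y : HG => y.1) x.
Proof. exact: (smooth_at_fst (x : H * G)). Qed.

Lemma smooth_at_sd2 (x : HG) : smooth_at (fun y : HG => y.2) x.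
Proof. exact: (smooth_at_snd (x : H * G)). Qed.

Lemma smooth_at_sdpair (M : chartedType R) {sM : smooth_space M} (f : M -> H)
    (h : M -> G) x :
  smooth_at f x -> smooth_at h x -> smooth_at (fun y => (f y, h y) : HG) x.
Proof. by move=> sf sh; exact: (smooth_at_pair sf sh). Qed.

Section SemidirectCoordinates.
Variable x : (HG * HG)%type.

Lemma smooth_at_sd11 : smooth_at (fun x : HG * HG => x.1.1) x.
Proof. by apply: (smooth_at_comp (smooth_at_fst x)); exact: smooth_at_sd1. Qed.

Lemma smooth_at_sd12 : smooth_at (fun x : HG * HG => x.1.2) x.
Proof. by apply: (smooth_at_comp (smooth_at_fst x)); exact: smooth_at_sd2. Qed.

Lemma smooth_at_sd21 : smooth_at (fun x : HG * HG => x.2.1) x.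
Proof. by apply: (smooth_at_comp (smooth_at_snd x)); exact: smooth_at_sd1. Qed.

Lemma smooth_at_sd22 : smooth_at (fun x : HG * HG => x.2.2) x.
Proof. by apply: (smooth_at_comp (smooth_at_snd x)); exact: smooth_at_sd2. Qed.

End SemidirectCoordinates.

Lemma lie_group_semidirect : lie_group HG.
Proof.
split; first exact: manifold_semidirect.
- move=> x; have s12 := smooth_at_sd12 x.
  apply: smooth_at_sdpair.
    apply: (smooth_at_mulg lH (smooth_at_sd11 x)).
    exact: (smooth_at_alpha cm s12 (smooth_at_sd21 x)).
  exact: (smooth_at_mulg lG s12 (smooth_at_sd22 x)).
- move=> x; have s1 := smooth_at_sd1 x; have s2 := smooth_at_sd2 x.
  have sV : smooth_at (fun x : HG => x.2^-1%g) x by exact: (smooth_at_invg lG s2).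
  have sV1 : smooth_at (fun x : HG => x.1^-1%g) x by exact: (smooth_at_invg lH s1).
  by apply: smooth_at_sdpair => //; exact: (smooth_at_alpha cm sV sV1).
Qed.

Lemma smooth_at_cm_tgt (x : HG) : smooth_at (@cm_tgt R G H cm) x.
Proof.
apply: (smooth_at_mulg lG _ (smooth_at_sd2 x)).
exact: (smooth_at_tau cm (smooth_at_sd1 x)).
Qed.

(** Composable pairs are given by [h2], [h1] and [g1], as [g2 = tau h1 * g1]. *)
Lemma slice_cm_composable (u : HG * HG) : cm_src u.1 = cm_tgt u.2 ->
  exists n, slice_at [set z : HG * HG | cm_src z.1 = cm_tgt z.2] u n.
Proof.
move=> uE.
pose F (z : HG * HG) : (H * HG) * G := ((z.1.1, z.2), z.1.2).
pose F' (w : (H * HG) * G) : HG * HG := ((w.1.1, w.2), w.1.2).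
have dF : diffeo_on setT setT F F'.
  split=> //; try exact: openT.
  - by move=> [[? ?] ?].
  - by move=> [[? ?] ?].
  - move=> z _; apply: smooth_at_pair; last exact: smooth_at_sd12.
    by apply: smooth_at_pair; [exact: smooth_at_sd11|exact: smooth_at_snd].
  - move=> w _.
    have s1 : smooth_at (fun w : (H * HG) * G => w.1.1) w.
      by apply: (smooth_at_comp (smooth_at_fst w)); exact: smooth_at_fst.
    have s2 : smooth_at (fun w : (H * HG) * G => w.1.2) w.
      by apply: (smooth_at_comp (smooth_at_fst w)); exact: smooth_at_snd.
    apply: smooth_at_pair => //; apply: smooth_at_sdpair => //.
    exact: smooth_at_snd.
have sHHG : smooth_space (H * HG)%type by exact: smooth_space_prod.
have [c ac cx] := ss_cover sHHG (u.1.1, u.2).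
have st : slice_at setT ((u.1.1, u.2) : H * HG) (cdim c).
  exact: slice_setT (atlas_max sHHG ac) cx.
have sg : forall m : H * HG, setT m -> smooth_at (fun m : H * HG => cm_tgt m.2) m.
  by move=> m _; apply: (smooth_at_comp (smooth_at_snd m)); exact: smooth_at_cm_tgt.
pose proof (slice_graph (@openT _) I sg st) as sl; exists (cdim c).
apply: (slice_diffeo dF) => //=; first last.
  by move: sl; rewrite -uE; exact.
by move=> x _; split=> [|[]].
Qed.

Lemma smooth_space_cm_composable :
  smooth_space (fibprod (@cm_src R G H cm) (@cm_tgt R G H cm)).
Proof.
apply: (@sub_smooth_space R (HG * HG)%type
  (smooth_space_prod smooth_space_HG smooth_space_HG)).
exact: slice_cm_composable.
Qed.

Lemma lie_groupoid_cm : lie_groupoid (cm_two_group cm).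
Proof.
have sC := smooth_space_cm_composable.
have inv_smooth : smooth (fun x : HG => (x.1^-1%g, cm_tgt x) : HG).
  move=> x; apply: smooth_at_sdpair; last exact: smooth_at_cm_tgt.
  exact: (smooth_at_invg lH (smooth_at_sd1 x)).
have inv_inv : involutive (fun x : HG => (x.1^-1%g, cm_tgt x) : HG).
  by move=> [h g] /=; rewrite /cm_tgt /= invgK tauV mulKg.
have src_subm : submersion (@cm_src R G H cm).
  move=> [h g]; apply: (@submersion_at_section R HG G _ _ (@cm_src R G H cm)
    (fun g => (h, g) : HG) g).
  - by apply: smooth_at_sdpair; [exact: smooth_at_cst|exact: smooth_at_id].
  - exact: smooth_at_sd2.
  - exact: nearW.
split.
- exact: lie_group_manifold lG.
- exact: manifold_semidirect.
- exact: smooth_at_sd2.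
- exact: smooth_at_cm_tgt.
- exact: src_subm.
- move=> x.
  exact: (submersion_at_comp (submersion_involution inv_smooth inv_inv x) (src_subm _)).
- by move=> g _; exists (1%g, g).
- by move=> g _; exists (1%g, g) => //; rewrite /= /cm_tgt /= tau1 mul1g.
- move=> u; have s1 := @smooth_at_fp1 R HG HG G (@cm_src R G H cm) (@cm_tgt R G H cm)
    smooth_space_HG smooth_space_HG sC u.
  have s2 := @smooth_at_fp2 R HG HG G (@cm_src R G H cm) (@cm_tgt R G H cm)
    smooth_space_HG smooth_space_HG sC u.
  apply: smooth_at_sdpair; last exact: (smooth_at_comp s2 (smooth_at_sd2 _)).
  apply: (smooth_at_mulg lH).
    exact: (smooth_at_comp s1 (smooth_at_sd1 _)).
  exact: (smooth_at_comp s2 (smooth_at_sd1 _)).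
- by move=> g; apply: smooth_at_sdpair; [exact: smooth_at_cst|exact: smooth_at_id].
- exact: inv_smooth.
- by [].
- by move=> b a e; rewrite /= /cm_tgt /= cm_tauM -mulgA; congr (_ * _)%g; exact: esym e.
- by [].
- by move=> g; rewrite /= /cm_tgt /= tau1 mul1g.
- by [].
- by move=> [h g]; rewrite /= /cm_tgt /= tauV mulKg.
- by move=> c b a ecb eba e e'; rewrite /= /gcomp /= mulgA.
- by move=> [h g] e; rewrite /gcomp /= mul1g.
- by move=> [h g] e; rewrite /gcomp /= mulg1.
- by move=> [h g] e; rewrite /gcomp /= mulVg.
- by move=> [h g] e; rewrite /gcomp /= mulgV.
Qed.

Lemma semidirect_mulE (x y : HG) :
  (x * y)%g = (x.1 * alpha cm x.2 y.1, x.2 * y.2)%g :> HG.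
Proof. by []. Qed.

Lemma semidirect_invE (x : HG) :
  (x^-1)%g = (alpha cm (x.2^-1) (x.1^-1), x.2^-1)%g :> HG.
Proof. by []. Qed.

Lemma lie_two_group_cm : lie_two_group (cm_two_group cm).
Proof.
split; first exact: lie_groupoid_cm.
- exact: lG.
- exact: lie_group_semidirect.
- split.
  + exact: lie_group_mul lG.
  + exact: lie_group_mul lie_group_semidirect.
  + by [].
  + move=> [[h g] [h' g']] /=; rewrite /cm_tgt /= cm_tauM cm_tau_alpha.
    by rewrite !mulgA mulgVK.
  + by move=> [g g']; rewrite /= semidirect_mulE /= alpha_one mul1g.
  + move=> [[h2 g2] [h2' g2']] [[h1 g1] [h1' g1']] e e'.
    have [/= e1 e2] := e; rewrite /gcomp /= /fpair /fp1 /fp2 /=.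
    rewrite !semidirect_mulE /= cm_alphaM e1 /cm_tgt /= cm_alpha_act cm_alpha_tau.
    by rewrite !mulgA mulgVK.
- split.
  + exact: lie_group_inv lG.
  + exact: lie_group_inv lie_group_semidirect.
  + by [].
  + move=> [h g] /=; rewrite /cm_tgt /= cm_tau_alpha tauV invgK invgM.
    by rewrite mulgK.
  + by move=> g; rewrite /= semidirect_invE /= invg1 alpha_one.
  + move=> [h2 g2] [h1 g1] e e'; rewrite /gcomp /= /fpair /fp1 /fp2 /=.
    rewrite !semidirect_invE /=; move: e => /= ->; rewrite /cm_tgt /=.
    rewrite [in RHS]invgM cm_alpha_act -tauV cm_alpha_tau invgK.
    by rewrite -cm_alphaM mulgK invgM.
Qed.

End TwoGroup.

(** * Pullbacks of principal bundles *)

Section PrincipalPullback.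
Context {R : realType} {P M : chartedType R} {G : chartedGroupType R}.
Context {proj : P -> M} {a : P * G -> P} (pb : principal_bundle proj a).
Context {N : chartedType R} (mN : manifold N) {s : N -> M} (ss : smooth s).

#[local] Instance pb_smooth_space_P : smooth_space P :=
  manifold_smooth_space (pb_total pb).
#[local] Instance pb_smooth_space_M : smooth_space M :=
  manifold_smooth_space (pb_base pb).
#[local] Instance pb_smooth_space_G : smooth_space G :=
  lie_group_smooth_space (pb_group pb).
#[local] Instance pb_smooth_space_N : smooth_space N :=
  manifold_smooth_space mN.

Lemma smooth_at_ract (L : chartedType R) {sL : smooth_space L} (f : L -> P)
    (g : L -> G) x :
  smooth_at f x -> smooth_at g x -> smooth_at (fun y => a (f y, g y)) x.
Proof.
move=> sf sg.
exact: (smooth_at_comp (smooth_at_pair sf sg) (pb_act_smooth pb _)).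
Qed.

Lemma open_bundle_preimage (U : set M) : open U -> open (proj @^-1` U).
Proof.
move: U; apply/continuousP => p.
exact: (smooth_at_continuous (pb_proj_smooth pb p)).
Qed.

(** Over a trivializing open set, [s n = proj p] says that [p] is the point of
    coordinates [(s n, g)], so that the pullback is the graph of [s] over
    [N * G]. *)
Lemma slice_pullback : exists n, forall u : N * P, s u.1 = proj u.2 ->
  slice_at [set u : N * P | s u.1 = proj u.2] u n.
Proof.
have [n1 Hn1] := manifold_dim mN.
have [n2 Hn2] := manifold_dim (lie_group_manifold (pb_group pb)).
exists (n1 + n2)%N => u uE.
have [U [Phi [Psi [oU Uu [tP tM _]]]]] := pb_trivial pb (proj u.2).
pose F (z : N * P) : (N * G) * M := ((z.1, (Phi z.2).2), proj z.2).
pose F' (w : (N * G) * M) : N * P := (w.1.1, Psi (w.2, w.1.2)).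
have PhiE p : U (proj p) -> Phi p = (proj p, (Phi p).2).
  by move=> Up; have [_ <- _] := tP p Up; case: (Phi p).
have dF : diffeo_on [set z : N * P | U (proj z.2)] [set w : (N * G) * M | U w.2] F F'.
  split.
  - apply: (continuousP (snd : N * P -> P)).1 (open_bundle_preimage oU).
    by move=> z; exact: cvg_snd.
  - apply: (continuousP (snd : (N * G) * M -> M)).1 oU.
    by move=> z; exact: cvg_snd.
  - by [].
  - by move=> [[n g] x] /= Ux; have [_ -> _] := tM x g Ux.
  - move=> [n p] /= Up; rewrite /F' /F /= -PhiE//.
    by have [_ _ ->] := tP p Up.
  - by move=> [[n g] x] /= Ux; rewrite /F' /F /=; have [_ -> ->] := tM x g Ux.
  - move=> z Uz; have s2 : smooth_at (snd : N * P -> P) z by exact: smooth_at_snd.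
    apply: smooth_at_pair.
      apply: smooth_at_pair; first exact: smooth_at_fst.
      have [sP _ _] := tP _ Uz.
      have sPhi : smooth_at (fun z : N * P => Phi z.2) z by exact: (smooth_at_comp s2 sP).
      by apply: (smooth_at_comp sPhi); exact: smooth_at_snd.
    exact: (smooth_at_comp s2 (pb_proj_smooth pb _)).
  - move=> w Uw; have s1 : smooth_at (fun w : (N * G) * M => w.1.1) w.
      by apply: (smooth_at_comp (smooth_at_fst w)); exact: smooth_at_fst.
    have s2 : smooth_at (fun w : (N * G) * M => w.1.2) w.
      by apply: (smooth_at_comp (smooth_at_fst w)); exact: smooth_at_snd.
    apply: smooth_at_pair => //.
    have s3 : smooth_at (fun w : (N * G) * M => (w.2, w.1.2)) w.
      by apply: smooth_at_pair => //; exact: smooth_at_snd.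
    apply: (smooth_at_comp s3).
    by have [] := tM w.2 w.1.2 Uw.
have [c ac cx] := ss_cover pb_smooth_space_N u.1.
have [d ad dx] := ss_cover pb_smooth_space_G (Phi u.2).2.
have sNG : smooth_space (N * G)%type by exact: smooth_space_prod.
have ace : (atlas : set (chart R (N * G)%type)) (prod_chart c d) by exists c, d.
have st : slice_at setT ((u.1, (Phi u.2).2) : N * G) (n1 + n2).
  rewrite -(Hn1 c)//; last by exists u.1.
  rewrite -(Hn2 d)//; last by exists (Phi u.2).2.
  exact: (@slice_setT _ _ sNG (prod_chart c d) _ (atlas_max sNG ace)).
have sf : forall m : N * G, setT m -> smooth_at (fun m : N * G => s m.1) m.
  by move=> m _; apply: (smooth_at_comp (smooth_at_fst m)); exact: ss.
pose proof (slice_graph (@openT _) I sf st) as sl.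
apply: (slice_diffeo dF Uu _ _) => /=; last by move: sl => /=; rewrite uE; exact.
by move=> [n p] /= Up; split=> [->//|[_ ->]].
Qed.

Lemma manifold_pullback : manifold (fibprod s proj).
Proof.
have [n sl] := slice_pullback.
exact: (@manifold_sub R (N * P)%type [set u | s u.1 = proj u.2] n
  (manifold_prod mN (pb_total pb)) sl).
Qed.
#[local] Instance smooth_space_pullback : smooth_space (fibprod s proj) :=
  manifold_smooth_space manifold_pullback.

Section Trivialized.
Variables (U : set M) (Phi : P -> M * G) (Psi : M * G -> P).
Hypotheses (oU : open U) (tr : local_trivialization proj a U Phi Psi).

Lemma trivialization_pair p : U (proj p) -> (proj p, (Phi p).2) = Phi p.
Proof. by case: tr => tP _ _ Up; have [_ <- _] := tP p Up; case: (Phi p). Qed.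

Lemma smooth_at_trivialization_snd p :
  U (proj p) -> smooth_at (fun q => (Phi q).2) p.
Proof.
case: tr => tP _ _ Up; have [sP _ _] := tP p Up.
by apply: (smooth_at_comp sP); exact: smooth_at_snd.
Qed.

Lemma pullback_coord_fibre x g : U x -> proj (Psi (x, g)) = x.
Proof. by case: tr => _ tM _ Ux; have [_ -> _] := tM x g Ux. Qed.

(** The local parametrization of the pullback by [N * G], precomposed with
    arbitrary smooth maps into [N] and [G]. *)
Lemma smooth_at_pullback_coord (u0 : fibprod s proj) (L : chartedType R)
    {sL : smooth_space L} (f : L -> N) (g : L -> G) x :
  U (s (f x)) -> smooth_at f x -> smooth_at g x ->
  smooth_at (fun y => fp_insub u0 (f y) (Psi (s (f y), g y))) x.
Proof.
move=> Ux sf sg.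
have ssf : smooth_at (fun y => s (f y)) x by apply: (smooth_at_comp sf); exact: ss.
have nU : \forall y \near x, U (s (f y)).
  have nU0 : nbhs (s (f x)) U by exact: open_nbhs_nbhs.
  exact: (@smooth_at_continuous _ _ _ _ _ _ _ ssf _ nU0).
have e y : U (s (f y)) -> s (f y) = proj (Psi (s (f y), g y)).
  by move=> Uy; rewrite pullback_coord_fibre.
apply: (@smooth_at_to_fibprod R N P M s proj pb_smooth_space_N
  pb_smooth_space_P smooth_space_pullback L sL).
  apply: smooth_at_eq sf; apply: filterS nU => y Uy.
  by rewrite fp1_insub//; exact: e.
have sPsi : smooth_at (fun y => Psi (s (f y), g y)) x.
  apply: (smooth_at_comp (smooth_at_pair ssf sg)).
  by case: tr => _ tM _; have [] := tM _ (g x) Ux.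
apply: smooth_at_eq sPsi; apply: filterS nU => y Uy.
by rewrite fp2_insub//; exact: e.
Qed.

Lemma pullback_coordK (u0 u : fibprod s proj) : U (s (fp1 u)) ->
  fp_insub u0 (fp1 u) (Psi (s (fp1 u), (Phi (fp2 u)).2)) = u.
Proof.
rewrite fpE => Uu; rewrite trivialization_pair//.
case: tr => tP _ _; have [_ _ ->] := tP _ Uu.
by rewrite (fp_insubE _ (fpE u)); exact: fp_eq.
Qed.

End Trivialized.

(** In the parametrization of the pullback by [N * G], the second projection is the
    composite of [s * id] with the local diffeomorphism [Psi]. *)
Lemma submersion_pullback_snd : submersion s -> submersion (@fp2 R N P M s proj).
Proof.
move=> subs u.
have [U [Phi [Psi [oU Uu tr]]]] := pb_trivial pb (proj (fp2 u)).
have Usu : U (s (fp1 u)) by rewrite fpE.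
pose z0 : N * G := (fp1 u, (Phi (fp2 u)).2).
pose k (z : N * G) : fibprod s proj := fp_insub u z.1 (Psi (s z.1, z.2)).
have kz0 : k z0 = u by exact: (pullback_coordK tr).
have sk : smooth_at k z0.
  apply: (smooth_at_pullback_coord oU tr) => //; first exact: smooth_at_fst.
  exact: smooth_at_snd.
have sfp := @smooth_at_fp2 R N P M s proj pb_smooth_space_N
  pb_smooth_space_P smooth_space_pullback (k z0).
suff : submersion_at (@fp2 R N P M s proj) (k z0) by rewrite kz0.
apply: (submersion_at_cancel sk sfp).
have [tP tM _] := tr.
have subPsi : submersion_at Psi (s z0.1, z0.2).
  rewrite /= fpE (trivialization_pair tr)//.
  have [sPhi _ _] := tP _ Uu.
  apply: submersion_at_section => //.
    by rewrite -(trivialization_pair tr)//; have [] := tM _ (Phi (fp2 u)).2 Uu.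
  have nU : nbhs (fp2 u) (proj @^-1` U).
    by apply: open_nbhs_nbhs; split=> //; exact: open_bundle_preimage.
  by apply: filterS nU => p Up; have [_ _ ->] := tP p Up.
have sub1 : submersion_at (fun z : N * G => (s z.1, z.2)) z0.
  by apply: submersion_at_prod_id; exact: subs.
apply: (submersion_at_eq _ (submersion_at_comp sub1 subPsi)).
have nU : \forall z \near z0, U (s z.1).
  have sc : smooth_at (fun z : N * G => s z.1) z0.
    by apply: (smooth_at_comp (smooth_at_fst z0)); exact: ss.
  have nU0 : nbhs (s z0.1) U by exact: open_nbhs_nbhs.
  exact: (@smooth_at_continuous _ _ _ _ _ _ _ sc _ nU0).
apply: filterS nU => z Uz; rewrite /k /= fp2_insub//.
by rewrite (pullback_coord_fibre tr).
Qed.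

End PrincipalPullback.

(** * Generalities on groupoids *)

Lemma open_preimage_smooth (R : realType) (M N : chartedType R)
    {sM : smooth_space M} {sN : smooth_space N} (f : M -> N) (U : set N) :
  smooth f -> open U -> open (f @^-1` U).
Proof.
move=> sf; move: U; apply/continuousP => x; exact: (smooth_at_continuous (sf x)).
Qed.

Section ComposablePairs.
Context {R : realType} {X : groupoid R} (lgX : lie_groupoid X).

#[local] Instance smooth_space_mor : smooth_space (mor X) :=
  manifold_smooth_space (lg_mor lgX).

(** A chart of the manifold of composable pairs at [u], which the smoothness of
    the composition presupposes, is a slice chart. *)
Lemma slice_composable (u : mor X * mor X) : src u.1 = tgt u.2 ->
  exists n, slice_at [set u : mor X * mor X | src u.1 = tgt u.2] u n.
Proof.
move=> uE; have [c [_ [_ [ac _ [cx _ _ _]]]]] := lg_comp_smooth lgX (fpair u.1 u.2 uE).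
have [n [l [U [phi [mc Aphi cE]]]]] := sub_atlasP ac.
exists n, l, U, phi; split=> //.
by move: cx; rewrite cE /=; case: (u).
Qed.

Lemma smooth_space_composable : smooth_space (fibprod (@src R X) (@tgt R X)).
Proof.
apply: (@sub_smooth_space R (mor X * mor X)%type
  (smooth_space_prod smooth_space_mor smooth_space_mor)).
exact: slice_composable.
Qed.

End ComposablePairs.

Lemma submersion_fst (R : realType) (M N : chartedType R) {sM : smooth_space M}
    {sN : smooth_space N} : submersion (fst : M * N -> M).
Proof.
move=> [x y].
apply: (@submersion_at_section R (M * N)%type M _ _ fst (fun x => (x, y)) x).
- by apply: smooth_at_pair; [exact: smooth_at_id|exact: smooth_at_cst].
- exact: smooth_at_fst.
- exact: nearW.
Qed.

Lemma gcomp_eq (R : realType) (X : groupoid R) (b a b' a' : mor X) e e' :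
  b = b' -> a = a' -> gcomp b a e = gcomp b' a' e'.
Proof. by move=> eb ea; congr gcomp_fp; exact: fpair_eq. Qed.

(** The algebraic part of [lie_groupoid]. It is established first because the target
    map is shown to be a submersion as the composite of the source map with the
    inversion, a diffeomorphism by [ginv_involutive]. *)
Record groupoid_laws (R : realType) (Y : groupoid R) : Prop := {
  gl_src_comp : forall (b a : mor Y) e, src (gcomp b a e) = src a;
  gl_tgt_comp : forall (b a : mor Y) e, tgt (gcomp b a e) = tgt b;
  gl_src_unit : forall y : obj Y, src (gunit y) = y;
  gl_tgt_unit : forall y : obj Y, tgt (gunit y) = y;
  gl_src_inv : forall a : mor Y, src (ginv a) = tgt a;
  gl_tgt_inv : forall a : mor Y, tgt (ginv a) = src a;
  gl_compA : forall (c b a : mor Y) ecb eba e e',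
    gcomp c (gcomp b a eba) e = gcomp (gcomp c b ecb) a e';
  gl_comp1l : forall (a : mor Y) e, gcomp (gunit (tgt a)) a e = a;
  gl_comp1r : forall (a : mor Y) e, gcomp a (gunit (src a)) e = a;
  gl_compVl : forall (a : mor Y) e, gcomp (ginv a) a e = gunit (src a);
  gl_compVr : forall (a : mor Y) e, gcomp a (ginv a) e = gunit (tgt a)
}.

(** [(a^-1)^-1 = (a^-1)^-1 (a^-1 a) = ((a^-1)^-1 a^-1) a = a]. *)
Lemma ginv_involutive (R : realType) (Y : groupoid R) :
  groupoid_laws Y -> involutive (@ginv R Y).
Proof.
move=> L a; set i := ginv a; set j := ginv i.
have eia : src i = tgt a by exact: gl_src_inv.
have eji : src j = tgt i by exact: gl_src_inv.
have ej : src j = tgt (gunit (src j)) by rewrite (gl_tgt_unit L).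
have e : src j = tgt (gcomp i a eia) by rewrite (gl_tgt_comp L).
have e' : src (gcomp j i eji) = tgt a by rewrite (gl_src_comp L).
have e1 : src (gunit (tgt a)) = tgt a by exact: gl_src_unit.
rewrite -[LHS](gl_comp1r L ej) -[RHS](gl_comp1l L e1).
transitivity (gcomp j (gcomp i a eia) e).
  by apply: gcomp_eq => //; rewrite (gl_compVl L) eji (gl_tgt_inv L).
rewrite (gl_compA L (ecb := eji) (eba := eia) e e'); apply: gcomp_eq => //.
by rewrite (gl_compVl L) eia.
Qed.

(** * Arrows and composable pairs of the decorated groupoid *)

Section DecoratedGroupoid.
Context {R : realType} {G H : chartedGroupType R} {X : groupoid R}.
Variables (E : quasi_principal_bundle G X) (cm : crossed_module G H).

Local Notation muE := (@mu R G X E).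
Local Notation piE := (@bproj R G X E).
Local Notation raE := (@ract R G X E).
Local Notation Q := (fibprod (@src R X) piE).
Local Notation D := (@qdec_mor R G H X E).

Let bE := qpb_principal E.
Let lgX := qpb_base E.
Let lG := cm_lieG cm.
Let lH := cm_lieH cm.

#[local] Instance qdec_smooth_G : smooth_space G := lie_group_smooth_space lG.
#[local] Instance qdec_smooth_H : smooth_space H := lie_group_smooth_space lH.
#[local] Instance qdec_smooth_X0 : smooth_space (obj X) :=
  manifold_smooth_space (lg_obj lgX).
#[local] Instance qdec_smooth_X1 : smooth_space (mor X) :=
  manifold_smooth_space (lg_mor lgX).
#[local] Instance qdec_smooth_E : smooth_space (tot E) :=
  manifold_smooth_space (pb_total bE).
#[local] Instance qdec_smooth_X2 : smooth_space (fibprod (@src R X) (@tgt R X)) :=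
  smooth_space_composable lgX.

Lemma manifold_quasi_domain : manifold Q.
Proof. exact (manifold_pullback bE (lg_mor lgX) (lg_src_smooth lgX)). Qed.
#[local] Instance qdec_smooth_Q : smooth_space Q :=
  manifold_smooth_space manifold_quasi_domain.

Lemma manifold_qdec_mor : manifold D.
Proof. exact: (manifold_prod manifold_quasi_domain (lie_group_manifold lH)). Qed.
#[local] Instance qdec_smooth_D : smooth_space D :=
  manifold_smooth_space manifold_qdec_mor.

Lemma smooth_at_arrow (q : Q) : smooth_at (fp1 : Q -> mor X) q.
Proof.
exact: (@smooth_at_fp1 R _ _ _ (@src R X) piE qdec_smooth_X1 qdec_smooth_E
  qdec_smooth_Q q).
Qed.

Lemma smooth_at_point (q : Q) : smooth_at (fp2 : Q -> tot E) q.
Proof.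
exact: (@smooth_at_fp2 R _ _ _ (@src R X) piE qdec_smooth_X1 qdec_smooth_E
  qdec_smooth_Q q).
Qed.

Lemma smooth_at_to_quasi_domain (L : chartedType R) {sL : smooth_space L}
    (h : L -> Q) x :
  smooth_at (fun y => fp1 (h y)) x -> smooth_at (fun y => fp2 (h y)) x ->
  smooth_at h x.
Proof.
exact: (@smooth_at_to_fibprod R _ _ _ (@src R X) piE qdec_smooth_X1
  qdec_smooth_E qdec_smooth_Q L sL h x).
Qed.

Lemma smooth_at_qdec1 (a : D) : smooth_at (fun a : D => a.1) a.
Proof. exact: (@smooth_at_fst R Q H qdec_smooth_Q qdec_smooth_H a). Qed.

Lemma smooth_at_qdec2 (a : D) : smooth_at (fun a : D => a.2) a.
Proof. exact: (@smooth_at_snd R Q H qdec_smooth_Q qdec_smooth_H a). Qed.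

Lemma smooth_at_to_qdec (L : chartedType R) {sL : smooth_space L} (f : L -> Q)
    (h : L -> H) x :
  smooth_at f x -> smooth_at h x -> smooth_at (fun y => (f y, h y) : D) x.
Proof. exact: (@smooth_at_pair R L Q H sL qdec_smooth_Q qdec_smooth_H f h x). Qed.

Lemma smooth_at_qdec_arrow (a : D) : smooth_at (fun a : D => fp1 a.1) a.
Proof. exact: (smooth_at_comp (smooth_at_qdec1 a) (smooth_at_arrow _)). Qed.

Lemma smooth_qdec_src : smooth (@qdec_src R G H X E).
Proof. move=> a; exact: (smooth_at_comp (smooth_at_qdec1 a) (smooth_at_point _)). Qed.

Lemma smooth_at_mu (L : chartedType R) {sL : smooth_space L} (h : L -> Q) x :
  smooth_at h x -> smooth_at (fun y => muE (h y)) x.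
Proof. by move=> sh; exact: (smooth_at_comp sh (qpb_mu_smooth (q := E) _)). Qed.

Lemma smooth_qdec_tgt : smooth (@qdec_tgt R G H X E cm).
Proof.
move=> a; apply: (smooth_at_ract bE).
  exact: (smooth_at_mu (smooth_at_qdec1 a)).
exact: (smooth_at_tau cm (smooth_at_invg lH (smooth_at_qdec2 a))).
Qed.

Lemma qdec_bproj_src (a : D) : piE (qdec_src a) = src (fp1 a.1).
Proof. exact: esym (fpE a.1). Qed.

(** Write [p1] and [p2] in trivializations, with coordinates [(s g1, k1)] and
    [(s g2, k2)]. Composability of [(g2, p2, h2)] and [(g1, p1, h1)] then says
    that [g2] and [g1] are composable and that [k2] is a function of
    [(g1, k1, h1)], so that the composable pairs form a graph over a product
    with the manifold of composable arrows. *)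
Lemma slice_qdec_composable (u : D * D) : qdec_src u.1 = qdec_tgt cm u.2 ->
  exists n, slice_at [set z : D * D | qdec_src z.1 = qdec_tgt cm z.2] u n.
Proof.
move=> uE.
have [U2 [Phi2 [Psi2 [oU2 Uu2 tr2]]]] := pb_trivial bE (piE (qdec_src u.1)).
have [U1 [Phi1 [Psi1 [oU1 Uu1 tr1]]]] := pb_trivial bE (piE (qdec_src u.2)).
pose B : chartedType R := (mor X * mor X)%type.
pose K : chartedType R := (H * (G * H))%type.
have sB : smooth_space B by exact: smooth_space_prod.
have sK : smooth_space K by exact: smooth_space_prod.
have sBK : smooth_space (B * K)%type by exact: smooth_space_prod.
have sN : smooth_space ((B * K) * G)%type by exact: smooth_space_prod.
have sDD : smooth_space (D * D)%type by exact: smooth_space_prod.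
have sS := lg_src_smooth lgX; have sT := lg_tgt_smooth lgX.
(* The graph lies over [B * K]: the coordinates are [(g2, g1)] on [B] and
   [(h2, (k1, h1))] on [K]. *)
have b1 (m : B * K) : smooth_at (fun m : B * K => m.1.1) m.
  by apply: (smooth_at_comp (smooth_at_fst m)); exact: smooth_at_fst.
have b2 (m : B * K) : smooth_at (fun m : B * K => m.1.2) m.
  by apply: (smooth_at_comp (smooth_at_fst m)); exact: smooth_at_snd.
have k1 (m : B * K) : smooth_at (fun m : B * K => m.2.1) m.
  by apply: (smooth_at_comp (smooth_at_snd m)); exact: smooth_at_fst.
have k2 (m : B * K) : smooth_at (fun m : B * K => m.2.2) m.
  by apply: (smooth_at_comp (smooth_at_snd m)); exact: smooth_at_snd.
have k21 (m : B * K) : smooth_at (fun m : B * K => m.2.2.1) m.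
  by apply: (smooth_at_comp (k2 m)); exact: smooth_at_fst.
have k22 (m : B * K) : smooth_at (fun m : B * K => m.2.2.2) m.
  by apply: (smooth_at_comp (k2 m)); exact: smooth_at_snd.
have sb1 (m : B * K) : smooth_at (fun m : B * K => src m.1.1) m.
  exact: (smooth_at_comp (b1 m) (sS _)).
have sb2 (m : B * K) : smooth_at (fun m : B * K => src m.1.2) m.
  exact: (smooth_at_comp (b2 m) (sS _)).
have tb2 (m : B * K) : smooth_at (fun m : B * K => tgt m.1.2) m.
  exact: (smooth_at_comp (b2 m) (sT _)).
pose q1 (m : B * K) : Q := fp_insub u.2.1 m.1.2 (Psi1 (src m.1.2, m.2.2.1)).
pose f (m : B * K) : G := (Phi2 (raE (muE (q1 m), tau cm (m.2.2.2^-1)%g))).2.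
pose O : set (B * K) := [set m | U1 (src m.1.2)] `&` [set m | U2 (tgt m.1.2)].
have oO : open O.
  by apply: openI; [exact: open_preimage_smooth sb2 oU1|exact: open_preimage_smooth tb2 oU2].
have q1_arrow m : U1 (src m.1.2) -> fp1 (q1 m) = m.1.2.
  by move=> Um; rewrite fp1_insub// (pullback_coord_fibre tr1).
have sq1 m : U1 (src m.1.2) -> smooth_at q1 m.
  move=> Um.
  exact (smooth_at_pullback_coord (f := fun m : B * K => m.1.2)
    (g := fun m : B * K => m.2.2.1) bE (lg_mor lgX) sS oU1 tr1 _ Um (b2 m) (k21 m)).
have sf m : O m -> smooth_at f m.
  move=> [Um Vm].
  have st : smooth_at (fun m => raE (muE (q1 m), tau cm (m.2.2.2^-1)%g)) m.
    apply: (smooth_at_ract bE); first exact: (smooth_at_mu (sq1 m Um)).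
    exact: (smooth_at_tau cm (smooth_at_invg lH (k22 m))).
  have Ut : U2 (piE (raE (muE (q1 m), tau cm (m.2.2.2^-1)%g))).
    by rewrite (pb_fibre bE) qpb_mu_proj q1_arrow.
  exact (smooth_at_comp st (smooth_at_trivialization_snd bE tr2 Ut)).
pose F (z : D * D) : (B * K) * G :=
  (((fp1 z.1.1, fp1 z.2.1), (z.1.2, ((Phi1 (fp2 z.2.1)).2, z.2.2))),
   (Phi2 (fp2 z.1.1)).2).
pose F' (w : (B * K) * G) : D * D :=
  ((fp_insub u.1.1 w.1.1.1 (Psi2 (src w.1.1.1, w.2)), w.1.2.1),
   (q1 w.1, w.1.2.2.2)).
pose V : set (D * D) := [set z | U2 (src (fp1 z.1.1))] `&`
  ([set z | U1 (src (fp1 z.2.1))] `&` [set z | U2 (tgt (fp1 z.2.1))]).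
pose W : set ((B * K) * G) := [set w | U2 (src w.1.1.1)] `&` [set w | O w.1].
have fF z : U1 (src (fp1 z.2.1)) -> f (F z).1 = (Phi2 (qdec_tgt cm z.2)).2.
  by move=> Uz; rewrite /f /q1 /= (pullback_coordK tr1).
have z1 (z : D * D) : smooth_at (fun z : D * D => z.1) z by exact: smooth_at_fst.
have z2 (z : D * D) : smooth_at (fun z : D * D => z.2) z by exact: smooth_at_snd.
have g1 (z : D * D) : smooth_at (fun z : D * D => fp1 z.1.1) z.
  exact: (smooth_at_comp (z1 z) (smooth_at_qdec_arrow _)).
have g2 (z : D * D) : smooth_at (fun z : D * D => fp1 z.2.1) z.
  exact: (smooth_at_comp (z2 z) (smooth_at_qdec_arrow _)).
have p1 (z : D * D) : smooth_at (fun z : D * D => fp2 z.1.1) z.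
  exact: (smooth_at_comp (z1 z) (smooth_qdec_src _)).
have p2 (z : D * D) : smooth_at (fun z : D * D => fp2 z.2.1) z.
  exact: (smooth_at_comp (z2 z) (smooth_qdec_src _)).
have dF : diffeo_on V W F F'.
  split.
  - apply: openI.
      apply: (@open_preimage_smooth _ _ _ _ _ (fun z : D * D => src (fp1 z.1.1))) => // z.
      exact: (smooth_at_comp (g1 z) (sS _)).
    apply: openI.
      apply: (@open_preimage_smooth _ _ _ _ _ (fun z : D * D => src (fp1 z.2.1))) => // z.
      exact: (smooth_at_comp (g2 z) (sS _)).
    apply: (@open_preimage_smooth _ _ _ _ _ (fun z : D * D => tgt (fp1 z.2.1))) => // z.
    exact: (smooth_at_comp (g2 z) (sT _)).
  - have w1 (w : (B * K) * G) : smooth_at (fun w : (B * K) * G => w.1) w.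
      exact: smooth_at_fst.
    apply: openI; last exact: (open_preimage_smooth w1 oO).
    apply: (@open_preimage_smooth _ _ _ _ _ (fun w : (B * K) * G => src w.1.1.1)) => // w.
    exact: (smooth_at_comp (w1 w) (sb1 _)).
  - by move=> z [Uz [Vz Tz]]; split.
  - move=> w [Uw [Vw Tw]]; split; [|split].
    + by rewrite /= fp1_insub// (pullback_coord_fibre tr2).
    + by rewrite /= q1_arrow.
    + by rewrite /= q1_arrow.
  - move=> [[x2 h2] [x1 h1]] [/= Uz [Vz Tz]]; rewrite /F' /F /q1 /=.
    by rewrite (pullback_coordK tr1)// (pullback_coordK tr2).
  - move=> [[[g g'] [h [k h']]] k'] [/= Uw [/= Vw Tw]].
    have e2 : src g = piE (Psi2 (src g, k')) by rewrite (pullback_coord_fibre tr2).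
    have e1 : src g' = piE (Psi1 (src g', k)) by rewrite (pullback_coord_fibre tr1).
    rewrite /F' /F /q1 /= !fp1_insub// !fp2_insub//.
    have [_ tM2 _] := tr2; have [_ tM1 _] := tr1.
    by have [_ _ ->] := tM2 _ k' Uw; have [_ _ ->] := tM1 _ k Vw.
  - move=> z [Uz [Vz Tz]].
    have c2 : smooth_at (fun z : D * D => (Phi2 (fp2 z.1.1)).2) z.
      have Uz' : U2 (piE (fp2 z.1.1)) by rewrite -fpE.
      exact (smooth_at_comp (p1 z) (smooth_at_trivialization_snd bE tr2 Uz')).
    have c1 : smooth_at (fun z : D * D => (Phi1 (fp2 z.2.1)).2) z.
      have Vz' : U1 (piE (fp2 z.2.1)) by rewrite -fpE.
      exact (smooth_at_comp (p2 z) (smooth_at_trivialization_snd bE tr1 Vz')).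
    have h1 : smooth_at (fun z : D * D => z.1.2) z.
      exact: (smooth_at_comp (z1 z) (smooth_at_qdec2 _)).
    have h2 : smooth_at (fun z : D * D => z.2.2) z.
      exact: (smooth_at_comp (z2 z) (smooth_at_qdec2 _)).
    exact: (smooth_at_pair (smooth_at_pair (smooth_at_pair (g1 z) (g2 z))
      (smooth_at_pair h1 (smooth_at_pair c1 h2))) c2).
  - move=> w [Uw [Vw Tw]].
    have w1 : smooth_at (fun w : (B * K) * G => w.1) w by exact: smooth_at_fst.
    have w2 : smooth_at (fun w : (B * K) * G => w.2) w by exact: smooth_at_snd.
    have w11 : smooth_at (fun w : (B * K) * G => w.1.1.1) w.
      exact: (smooth_at_comp w1 (b1 _)).
    apply: (@smooth_at_pair R _ D D sN qdec_smooth_D qdec_smooth_D).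
      apply: smooth_at_to_qdec; last exact: (smooth_at_comp w1 (k1 _)).
      exact (smooth_at_pullback_coord (f := fun w : (B * K) * G => w.1.1.1)
        (g := fun w : (B * K) * G => w.2) bE (lg_mor lgX) sS oU2 tr2 _ Uw w11 w2).
    apply: smooth_at_to_qdec; first exact: (smooth_at_comp w1 (sq1 _ Vw)).
    exact: (smooth_at_comp w1 (k22 _)).
have Vu : V u.
  have e : tgt (fp1 u.2.1) = piE (qdec_src u.1) by rewrite uE proj_qdec_tgt.
  by split; [|split]; rewrite /= ?e -?qdec_bproj_src.
have [n sl2] : exists n, slice_at [set u : B | src u.1 = tgt u.2] (F u).1.1 n.
  by apply: (slice_composable lgX); rewrite /= -qdec_bproj_src uE proj_qdec_tgt.
have [d ad dx] := ss_cover sK (F u).1.2.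
pose proof (slice_prod sl2 (atlas_max sK ad) dx) as slp.
have Om0 : O (F u).1 by case: Vu => _.
pose proof (slice_graph oO Om0 sf slp) as slg.
exists (n + cdim d)%N; rewrite (fF u) -?uE in slg; last by case: Vu => _ [].
refine (slice_diffeo dF Vu _ slg).
move=> z [Uz [Vz Tz]].
have [tP2 _ _] := tr2.
have Ps : U2 (piE (qdec_src z.1)) by rewrite qdec_bproj_src.
have Pt : U2 (piE (qdec_tgt cm z.2)) by rewrite proj_qdec_tgt.
split=> [e|[e1 e2]].
  split; first by rewrite /= -qdec_bproj_src e proj_qdec_tgt.
  by apply: etrans (esym (fF z Vz)); rewrite /= -e.
have [_ _ e3] := tP2 _ Ps; have [_ _ e4] := tP2 _ Pt.
rewrite /= -e3 -e4 -(trivialization_pair tr2 Ps) -(trivialization_pair tr2 Pt).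
rewrite qdec_bproj_src proj_qdec_tgt; congr (Psi2 (_, _)); first exact: e1.
exact: etrans e2 (fF z Vz).
Qed.

Lemma smooth_space_qdec_composable :
  smooth_space (fibprod (@qdec_src R G H X E) (@qdec_tgt R G H X E cm)).
Proof.
apply: (@sub_smooth_space R (D * D)%type (smooth_space_prod qdec_smooth_D qdec_smooth_D)).
exact: slice_qdec_composable.
Qed.

Variables (Hu : tot E -> H) (Hm : fibprod (@src R X) (@tgt R X) -> H).

Local Notation D2 := (fibprod (@qdec_src R G H X E) (@qdec_tgt R G H X E cm)).
Local Notation HG := (semidirect cm).
Local Notation EE := (qdec_groupoid cm Hu Hm).
#[local] Instance qdec_smooth_HG : smooth_space HG :=
  manifold_smooth_space (manifold_semidirect cm).
#[local] Instance qdec_smooth_D2 : smooth_space D2 := smooth_space_qdec_composable.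

Lemma qdec_eq (a b : D) :
  fp1 a.1 = fp1 b.1 -> fp2 a.1 = fp2 b.1 -> a.2 = b.2 -> a = b.
Proof.
by case: a b => [x h] [y k] /= e1 e2 ->; rewrite (fp_eq e1 e2).
Qed.

Lemma fp_eta (q : Q) e : fpair (fp1 q) (fp2 q) e = q.
Proof. exact: fp_eq. Qed.

Lemma ractM p g g' : raE (raE (p, g), g') = raE (p, (g * g')%g).
Proof. by case: (pb_action bE). Qed.

Lemma ract1 p : raE (p, 1%g) = p.
Proof. by case: (pb_action bE). Qed.

(** * Smoothness of the decorated structure maps *)

Section Smoothness.
Hypotheses (Hu_smooth : smooth Hu) (Hm_smooth : smooth Hm).

Lemma smooth_qdec_unit : smooth (qdec_unit Hu).
Proof.
move=> p; rewrite /qdec_unit; apply: (smooth_at_to_qdec); last exact: Hu_smooth.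
apply: (smooth_at_to_quasi_domain); last exact: smooth_at_id.
exact: (smooth_at_comp (pb_proj_smooth bE p) (lg_unit_smooth lgX _)).
Qed.

Lemma smooth_qdec_inv : smooth (qdec_inv cm Hu Hm).
Proof.
move=> a; have sa := smooth_at_qdec_arrow a.
have sV : smooth_at (fun a : D => ginv (fp1 a.1)) a.
  exact: (smooth_at_comp sa (lg_inv_smooth lgX _)).
rewrite /qdec_inv; apply: (smooth_at_to_qdec).
  by apply: (smooth_at_to_quasi_domain); [exact: sV|exact: smooth_qdec_tgt].
apply: (smooth_at_mulg lH); last exact: (smooth_at_invg lH (smooth_at_qdec2 a)).
apply: (smooth_at_mulg lH).
  exact: (smooth_at_comp (smooth_qdec_src a) (Hu_smooth _)).
pose j (a : D) := fpair (ginv (fp1 a.1)) (fp1 a.1) (lg_src_inv (qpb_base E) (fp1 a.1)).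
have s2 : smooth_at j a.
  exact (@smooth_at_to_fibprod R _ _ _ (@src R X) (@tgt R X) qdec_smooth_X1
    qdec_smooth_X1 qdec_smooth_X2 D qdec_smooth_D j a sV sa).
exact: (smooth_at_comp s2 (Hm_smooth _)).
Qed.

Lemma smooth_qdec_comp : smooth (@qdec_comp R G H X E cm Hm).
Proof.
move=> u.
have s1 := @smooth_at_fp1 R D D (tot E) (@qdec_src R G H X E)
  (@qdec_tgt R G H X E cm) qdec_smooth_D qdec_smooth_D qdec_smooth_D2 u.
have s2 := @smooth_at_fp2 R D D (tot E) (@qdec_src R G H X E)
  (@qdec_tgt R G H X E cm) qdec_smooth_D qdec_smooth_D qdec_smooth_D2 u.
have g1 : smooth_at (fun u : D2 => fp1 (fp1 u).1) u.
  exact: (smooth_at_comp s1 (smooth_at_qdec_arrow (fp1 u))).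
have g2 : smooth_at (fun u : D2 => fp1 (fp2 u).1) u.
  exact: (smooth_at_comp s2 (smooth_at_qdec_arrow (fp2 u))).
have h1 : smooth_at (fun u : D2 => (fp1 u).2) u.
  exact: (smooth_at_comp s1 (smooth_at_qdec2 (fp1 u))).
have h2 : smooth_at (fun u : D2 => (fp2 u).2) u.
  exact: (smooth_at_comp s2 (smooth_at_qdec2 (fp2 u))).
pose j (u : D2) := fpair (fp1 (fp1 u).1) (fp1 (fp2 u).1) (qdec_composable (cm := cm) u).
have sj : smooth_at j u.
  exact (@smooth_at_to_fibprod R _ _ _ (@src R X) (@tgt R X) qdec_smooth_X1
    qdec_smooth_X1 qdec_smooth_X2 _ qdec_smooth_D2 j u g1 g2).
rewrite /qdec_comp; apply: (smooth_at_to_qdec).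
  apply: (smooth_at_to_quasi_domain).
    exact: (smooth_at_comp sj (lg_comp_smooth lgX _)).
  exact: (smooth_at_comp s2 (smooth_qdec_src _)).
apply: (smooth_at_mulg lH); first exact: (smooth_at_mulg lH h1 h2).
exact: (smooth_at_invg lH (smooth_at_comp sj (Hm_smooth _))).
Qed.

Lemma submersion_qdec_src : submersion (@qdec_src R G H X E).
Proof.
move=> a.
have sub := submersion_pullback_snd bE (lg_mor lgX) (lg_src_smooth lgX) (lg_src_subm lgX).
exact: (submersion_at_comp (submersion_fst (M := Q) (N := H) a) (sub a.1)).
Qed.

Lemma smooth_qdec_act : smooth (@qdec_act R G H X E cm).
Proof.
move=> x.
have s1 : smooth_at (fst : D * HG -> D) x by exact: smooth_at_fst.
have s2 : smooth_at (snd : D * HG -> HG) x by exact: smooth_at_snd.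
have h' : smooth_at (fun x : D * HG => x.2.1) x.
  exact (smooth_at_comp s2 (smooth_at_sd1 (cm := cm) _)).
have g : smooth_at (fun x : D * HG => x.2.2) x.
  exact (smooth_at_comp s2 (smooth_at_sd2 (cm := cm) _)).
have h : smooth_at (fun x : D * HG => x.1.2) x.
  exact: (smooth_at_comp s1 (smooth_at_qdec2 _)).
have ga : smooth_at (fun x : D * HG => fp1 x.1.1) x.
  exact: (smooth_at_comp s1 (smooth_at_qdec_arrow _)).
have p : smooth_at (fun x : D * HG => fp2 x.1.1) x.
  exact: (smooth_at_comp s1 (smooth_qdec_src _)).
have e : qdec_act (cm := cm) = (fun x : D * HG =>
    (fpair (fp1 x.1.1) (raE (fp2 x.1.1, x.2.2)) (qdec_act_fibre x.1 x.2.2),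
     alpha cm (x.2.2^-1)%g (x.2.1^-1 * x.1.2)%g)).
  by apply/funext => -[a [k g0]].
rewrite e; apply: (smooth_at_to_qdec).
  apply: (smooth_at_to_quasi_domain); first exact: ga.
  exact: (smooth_at_ract bE p g).
apply: (smooth_at_alpha cm (smooth_at_invg lG g)).
exact: (smooth_at_mulg lH (smooth_at_invg lH h') h).
Qed.

End Smoothness.

(** * Coherence and the groupoid laws *)

Section Coherent.
Hypothesis coh : coherent cm Hu Hm.
Local Notation X2 := (fibprod (@src R X) (@tgt R X)).

(** The equivariance of [mu] and, in the next lemmas, the coherence properties are
    restated for points of the fibre products that are only known through their
    components. Equality of components then replaces all reasoning on proofs of
    composability. *)
Lemma mu_ractE (q q' : Q) g :
  fp1 q' = fp1 q -> fp2 q' = raE (fp2 q, g) -> muE q' = raE (muE q, g).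
Proof.
move=> e1 e2; have e : src (fp1 q) = piE (raE (fp2 q, g)) by rewrite -e1 -e2 fpE.
have -> : q' = fpair (fp1 q) (raE (fp2 q, g)) e by exact: fp_eq.
by rewrite (qpb_mu_equiv (fpE q)) fp_eta.
Qed.

Lemma mu_unitE (q : Q) :
  fp1 q = gunit (piE (fp2 q)) -> muE q = raE (fp2 q, tau cm (Hu (fp2 q))).
Proof.
move=> e1; have e : src (gunit (piE (fp2 q))) = piE (fp2 q) by rewrite -e1 fpE.
rewrite -(coh_a coh (p := fp2 q) e); congr muE; exact: fp_eq.
Qed.

Lemma mu_compE (q2 q1 q : Q) (v : X2) :
  fp2 q2 = muE q1 -> fp1 v = fp1 q2 -> fp2 v = fp1 q1 ->
  fp1 q = gcomp_fp v -> fp2 q = fp2 q1 -> muE q2 = raE (muE q, tau cm (Hm v)).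
Proof.
move=> e2 v1 v2 q1E q2E.
have e21 : src (fp1 q2) = tgt (fp1 q1) by rewrite -v1 -v2 fpE.
have vE : v = fpair (fp1 q2) (fp1 q1) e21 by exact: fp_eq.
have e' : src (fp1 q2) = piE (muE (fpair (fp1 q1) (fp2 q1) (fpE q1))).
  by rewrite fp_eta -e2 fpE.
have e : src (gcomp (fp1 q2) (fp1 q1) e21) = piE (fp2 q1).
  by rewrite /gcomp -vE -q1E -q2E fpE.
have E1 : q2 = fpair (fp1 q2) (muE (fpair (fp1 q1) (fp2 q1) (fpE q1))) e'.
  by apply: fp_eq; rewrite // fp2_fpair fp_eta e2.
have E2 : q = fpair (gcomp (fp1 q2) (fp1 q1) e21) (fp2 q1) e.
  by apply: fp_eq; rewrite // fp1_fpair /gcomp -vE.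
by rewrite E1 (coh_b coh e' e) -E2 -vE.
Qed.

Lemma Hm_unit_r (v : X2) p :
  fp2 v = gunit (piE p) -> src (fp1 v) = piE p -> Hm v = Hu p.
Proof.
move=> e2 e1; have e : src (fp1 v) = tgt (gunit (piE p)) by rewrite -e2 fpE.
have -> : v = fpair (fp1 v) (gunit (piE p)) e by exact: fp_eq.
exact: (coh_c coh).
Qed.

Lemma Hm_unit_l (v : X2) (q : Q) :
  fp1 v = gunit (piE (muE q)) -> fp2 v = fp1 q -> Hm v = Hu (muE q).
Proof.
move=> e1 e2.
have e : src (gunit (piE (muE (fpair (fp1 q) (fp2 q) (fpE q))))) = tgt (fp1 q).
  by rewrite fp_eta -e1 -e2 fpE.
have -> : v = fpair (gunit (piE (muE (fpair (fp1 q) (fp2 q) (fpE q))))) (fp1 q) e.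
  by apply: fp_eq; rewrite // fp1_fpair fp_eta.
by rewrite (coh_d coh e) fp_eta.
Qed.

Lemma Hm_cocycle (v32 v321 v21 v3_21 : X2) :
  fp1 v3_21 = fp1 v32 -> fp2 v32 = fp1 v21 -> fp2 v321 = fp2 v21 ->
  fp1 v321 = gcomp_fp v32 -> fp2 v3_21 = gcomp_fp v21 ->
  ((Hm v32)^-1 * (Hm v321)^-1 = (Hm v21)^-1 * (Hm v3_21)^-1)%g.
Proof.
move=> e3 e2 e1 c32 c21.
have E32 : src (fp1 v32) = tgt (fp1 v21) by rewrite -e2 fpE.
have v32E : v32 = fpair (fp1 v32) (fp1 v21) E32 by exact: fp_eq.
have v21E : v21 = fpair (fp1 v21) (fp2 v21) (fpE v21) by exact: fp_eq.
have E321 : src (gcomp (fp1 v32) (fp1 v21) E32) = tgt (fp2 v21).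
  by rewrite /gcomp -v32E -c32 -e1 fpE.
have E3_21 : src (fp1 v32) = tgt (gcomp (fp1 v21) (fp2 v21) (fpE v21)).
  by rewrite /gcomp -v21E -c21 -e3 fpE.
have := coh_j coh E321 E3_21.
have <- : v321 = fpair (gcomp (fp1 v32) (fp1 v21) E32) (fp2 v21) E321.
  by apply: fp_eq; rewrite // fp1_fpair c32 /gcomp -v32E.
have <- : v3_21 = fpair (fp1 v32) (gcomp (fp1 v21) (fp2 v21) (fpE v21)) E3_21.
  by apply: fp_eq; rewrite // fp2_fpair c21 /gcomp -v21E.
by rewrite -v32E -v21E.
Qed.

Lemma Hm_inv (v w : X2) (q : Q) :
  fp1 v = ginv (fp1 q) -> fp2 v = fp1 q -> fp1 w = fp1 q -> fp2 w = ginv (fp1 q) ->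
  (Hm v * (Hm w)^-1 = (Hu (fp2 q))^-1 * Hu (muE q))%g.
Proof.
move=> v1 v2 w1 w2.
have e' : src (ginv (fp1 q)) = tgt (fp1 q) by rewrite -v1 -v2 fpE.
have e'' : src (fp1 q) = tgt (ginv (fp1 q)) by rewrite -w2 -w1 fpE.
have := coh_k coh (fpE q) e' e''; rewrite fp_eta.
have <- : v = fpair (ginv (fp1 q)) (fp1 q) e' by exact: fp_eq.
by have <- : w = fpair (fp1 q) (ginv (fp1 q)) e'' by exact: fp_eq.
Qed.

Lemma Hm_invC u h : ((Hm u)^-1 * h = h * (Hm u)^-1)%g.
Proof. by apply: (@mulgI _ (Hm u)); rewrite mulVKg mulgA (coh_i coh) mulgK. Qed.

Lemma alpha_HmV g u : alpha cm g (Hm u)^-1%g = (Hm u)^-1%g.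
Proof. by rewrite -[g]invgK (coh_h coh). Qed.

(** By property (b), both sides are obtained from [mu (g2 \o g1, p1)] by acting
    with [tau (Hm (g2, g1) * h1^-1 * h2^-1)]. *)
Lemma qdec_tgt_comp (u : D2) :
  qdec_tgt cm (qdec_comp Hm u) = qdec_tgt cm (fp1 u).
Proof.
have eb : fp2 (fp1 u).1 = raE (muE (fp2 u).1, tau cm ((fp2 u).2^-1)%g).
  exact: fpE u.
have e2 : src (fp1 (fp1 u).1) = piE (muE (fp2 u).1).
  by rewrite fpE eb (pb_fibre bE).
rewrite /qdec_tgt.
rewrite (@mu_ractE (fpair (fp1 (fp1 u).1) (muE (fp2 u).1) e2) _ _ _ eb)//.
rewrite (@mu_compE (fpair (fp1 (fp1 u).1) (muE (fp2 u).1) e2) (fp2 u).1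
  (qdec_comp Hm u).1 (fpair (fp1 (fp1 u).1) (fp1 (fp2 u).1) (qdec_composable u)))//.
by rewrite !ractM -!cm_tauM /= !invgM invgK !mulgA.
Qed.

Lemma qdec_tgt_unit p : qdec_tgt cm (qdec_unit Hu p) = p.
Proof.
rewrite /qdec_tgt mu_unitE//= ractM -cm_tauM mulgV tau1.
exact: ract1.
Qed.

Lemma qdec_tgt_inv a : qdec_tgt cm (qdec_inv cm Hu Hm a) = qdec_src a.
Proof.
pose v : X2 := fpair (ginv (fp1 a.1)) (fp1 a.1) (lg_src_inv lgX (fp1 a.1)).
have e2 : src (ginv (fp1 a.1)) = piE (muE a.1).
  by rewrite (lg_src_inv lgX) qpb_mu_proj.
have e1 : src (gcomp_fp v) = piE (fp2 a.1) by rewrite (lg_src_comp lgX) fpE.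
rewrite /qdec_tgt.
rewrite (@mu_ractE (fpair (ginv (fp1 a.1)) (muE a.1) e2) _ (tau cm (a.2^-1)%g))//.
rewrite (@mu_compE _ a.1 (fpair (gcomp_fp v) (fp2 a.1) e1) v)//.
have vE : gcomp_fp v = gunit (piE (fp2 a.1)).
  by apply: etrans (lg_compVl lgX _) _; rewrite fpE.
rewrite (mu_unitE (q := fpair (gcomp_fp v) (fp2 a.1) e1) vE) /=.
rewrite !ractM -!cm_tauM /= !invgM invgK !mulgA mulgVK mulgK mulgV tau1.
exact: ract1.
Qed.

Lemma Hu_qdec_tgt a : Hu (qdec_tgt cm a) = Hu (muE a.1).
Proof. exact: coh_e coh _ _. Qed.

(** The arrows compose as in [X]; what has to be compared are the components in
    [H]. As the values of [Hu] and [Hm] are central, associativity is the cocycle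
    property (j), the unit laws are (c), (d) and (e), and the two inverse laws
    are related by (k). *)
Lemma groupoid_laws_qdec : groupoid_laws EE.
Proof.
split.
- by [].
- by move=> b a e; exact: (qdec_tgt_comp (fpair b a e)).
- by [].
- exact: qdec_tgt_unit.
- by [].
- exact: qdec_tgt_inv.
- move=> c b a ecb eba e e'; apply: qdec_eq => //; first exact: (lg_compA lgX).
  rewrite /= -!mulgA; congr (_ * (_ * _))%g.
  rewrite [RHS]mulgA [in RHS]Hm_invC -[RHS]mulgA; congr (_ * _)%g; apply: esym.
  by refine (@Hm_cocycle _ _ _ _ _ _ _ _ _).
- move=> a e; apply: qdec_eq => //=.
    apply: etrans (lg_comp1l lgX (lg_src_unit lgX _)).
    by apply: gcomp_eq => //; congr gunit; exact: proj_qdec_tgt.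
  rewrite (Hm_unit_l (q := a.1))//=.
    by rewrite Hu_qdec_tgt (coh_g coh) mulgK.
  by congr gunit; apply: etrans (proj_qdec_tgt cm a) (esym (qpb_mu_proj _)).
- move=> a e; apply: qdec_eq => //=.
    apply: etrans (lg_comp1r lgX (esym (lg_tgt_unit lgX _))).
    by apply: gcomp_eq => //; rewrite fpE.
  rewrite (Hm_unit_r (p := fp2 a.1)); [exact: mulgK|by []|exact: (fpE a.1)].
- move=> a e; apply: qdec_eq => //=.
    by apply: etrans (lg_compVl lgX _) _; rewrite fpE.
  rewrite mulgVK; set v := fpair _ _ _; set v' := fpair _ _ _.
  by have -> : v' = v by [exact: fp_eq]; rewrite mulgK.
- move=> a e; apply: qdec_eq => //=.
    apply: etrans (lg_compVr lgX _) _.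
    by have e1 := congr1 (@gunit R X) (proj_qdec_tgt cm a); exact (esym e1).
  rewrite Hu_qdec_tgt; set v : X2 := fpair _ _ (lg_src_inv _ _).
  set w : X2 := fpair _ _ (qdec_composable _).
  have zC h : (Hu (fp2 a.1) * Hm v * h = h * (Hu (fp2 a.1) * Hm v))%g.
    by rewrite -mulgA (coh_i coh) mulgA [(_ * h)%g](coh_g coh) -mulgA.
  by rewrite zC mulVKg -mulgA (@Hm_inv v w a.1)// mulVKg.
Qed.

Lemma lie_groupoid_qdec (Hu_smooth : smooth Hu) (Hm_smooth : smooth Hm) :
  lie_groupoid EE.
Proof.
have sinv := smooth_qdec_inv Hu_smooth Hm_smooth.
have L := groupoid_laws_qdec.
split; try by case: L.
- exact: pb_total bE.
- exact (manifold_qdec_mor).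
- exact (smooth_qdec_src).
- exact (smooth_qdec_tgt).
- exact submersion_qdec_src.
- move=> a.
  have sub : submersion_at (qdec_inv cm Hu Hm) a.
    exact: (submersion_involution sinv (ginv_involutive L) a).
  exact (submersion_at_comp sub (submersion_qdec_src _)).
- by move=> p _; exists (qdec_unit Hu p).
- by move=> p _; exists (qdec_unit Hu p) => //; exact: qdec_tgt_unit.
- exact (smooth_qdec_comp Hm_smooth).
- exact (smooth_qdec_unit Hu_smooth).
Qed.

(** * The principal 2-bundle and its quasi connection *)

Lemma right_action_qdec : right_action (@qdec_act R G H X E cm).
Proof.
split=> [a|a [h g] [h' g']].
  change (qdec_act (cm := cm) (a, (1%g, 1%g)) = a).
  apply: qdec_eq; [by []|exact: ract1|].
  by rewrite /= !invg1 mul1g cm_alpha1.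
apply: qdec_eq; [by []|exact: ractM|].
change (alpha cm g'^-1 (h'^-1 * alpha cm g^-1 (h^-1 * a.2)) =
  alpha cm (g * g')^-1 ((h * alpha cm g h')^-1 * a.2))%g.
rewrite [((g * g')^-1)%g]invgM cm_alpha_act; congr (alpha cm _ _).
rewrite [((h * _)^-1)%g]invgM -alphaV -mulgA [in RHS]cm_alphaM.
by rewrite -cm_alpha_act mulVg cm_alpha1.
Qed.

(** Over a trivializing open set, the decorated bundle is trivialized by the
    section [g |-> (g, Psi (s g, 1), 1)]: the arrow [(g, p, h)] with [p] of
    coordinate [k] is the translate of that section by [(alpha_k h^-1, k)]. *)
Lemma principal_bundle_qdec :
  principal_bundle (@qdec_proj R G H X E) (@qdec_act R G H X E cm).
Proof.
split.
- exact: lie_group_semidirect.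
- exact (manifold_qdec_mor).
- exact: lg_mor lgX.
- exact (smooth_at_qdec_arrow).
- exact: smooth_qdec_act.
- exact: right_action_qdec.
- by move=> a [h g].
move=> x.
have [U [Phi [Psi [oU Ux tr]]]] := pb_trivial bE (src x).
have sS := lg_src_smooth lgX.
have e0 : src x = piE (Psi (src x, 1%g)) by rewrite (pullback_coord_fibre tr).
(* A dummy value, which is available because [U] is not empty. *)
pose u0 : Q := fpair x (Psi (src x, 1%g)) e0.
pose k (a : D) : G := (Phi (fp2 a.1)).2.
pose F (a : D) : mor X * HG := (fp1 a.1, (alpha cm (k a) (a.2^-1)%g, k a)).
pose F' (w : mor X * HG) : D :=
  (fp_insub u0 w.1 (Psi (src w.1, w.2.2)), alpha cm (w.2.2^-1)%g (w.2.1^-1)%g).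
exists (@src R X @^-1` U), F, F'; split=> //.
  exact: open_preimage_smooth sS oU.
split.
- move=> a Ua; have Ua' : U (piE (fp2 a.1)) by rewrite -fpE.
  have sa := smooth_at_qdec_arrow a.
  have sk : smooth_at k a.
    exact (smooth_at_comp (smooth_qdec_src a)
      (smooth_at_trivialization_snd bE tr Ua')).
  have sh : smooth_at (fun a : D => (a.2^-1)%g) a.
    exact: (smooth_at_invg lH (smooth_at_qdec2 a)).
  split=> //.
    apply: (@smooth_at_pair R D (mor X) HG qdec_smooth_D qdec_smooth_X1 qdec_smooth_HG) => //.
    by apply: smooth_at_sdpair => //; exact: (smooth_at_alpha cm sk sh).
  rewrite /F' /F /=; apply: injective_projections; rewrite /=.
    exact: (pullback_coordK tr).
  by rewrite -alphaV invgK -cm_alpha_act mulVg cm_alpha1.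
- move=> g [h k0] Ug /=; rewrite /F' /F /k /qdec_proj /=.
  have eg : src g = piE (Psi (src g, k0)) by rewrite (pullback_coord_fibre tr).
  rewrite fp1_insub// fp2_insub//; have [_ tM _] := tr.
  have [_ _ ->] := tM _ k0 Ug; split=> //; last first.
    by rewrite -alphaV invgK -cm_alpha_act mulgV cm_alpha1.
  have s1 : smooth_at (fun w : mor X * HG => w.1) (g, (h, k0)) by exact: smooth_at_fst.
  have s2 : smooth_at (fun w : mor X * HG => w.2) (g, (h, k0)) by exact: smooth_at_snd.
  have s21 : smooth_at (fun w : mor X * HG => w.2.1) (g, (h, k0)).
    exact (smooth_at_comp s2 (smooth_at_sd1 (cm := cm) _)).
  have s22 : smooth_at (fun w : mor X * HG => w.2.2) (g, (h, k0)).
    exact (smooth_at_comp s2 (smooth_at_sd2 (cm := cm) _)).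
  apply: (smooth_at_to_qdec).
    exact (smooth_at_pullback_coord (f := fun w : mor X * HG => w.1)
      (g := fun w : mor X * HG => w.2.2) (x := (g, (h, k0)) : mor X * HG)
      bE (lg_mor lgX) sS oU tr u0 Ug s1 s22).
  exact: (smooth_at_alpha cm (smooth_at_invg lG s22) (smooth_at_invg lH s21)).
move=> a [h g] Ua; rewrite /F /k /=.
have Ua' : U (piE (fp2 a.1)) by rewrite -fpE.
have [_ _ tE] := tr; rewrite tE//=; congr (_, _); rewrite semidirect_mulE /=.
congr (_, _); rewrite -alphaV cm_alpha_act -cm_alphaM; congr (alpha cm _ _).
by rewrite -cm_alpha_act mulgV cm_alpha1 invgM invgK.
Qed.

Lemma lie_functor_qdec_proj : @lie_functor R EE X piE (@qdec_proj R G H X E).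
Proof.
split=> //.
- exact: pb_proj_smooth bE.
- exact (smooth_at_qdec_arrow).
- by move=> a; exact: (fpE a.1).
- by move=> a; exact: esym (proj_qdec_tgt cm a).
- by move=> b a e e'; exact: gcomp_eq.
Qed.

(** On the components in [H], compatibility with the units is the invariance of
    [Hu], and compatibility with the composition uses that of [Hm] and the
    Peiffer identity [cm_alpha_tau], which turns the action of [tau h1] into a
    conjugation. *)
Lemma lie_functor_qdec_act :
  @lie_functor R (prod_groupoid EE (cm_two_group cm)) EE raE (@qdec_act R G H X E cm).
Proof.
split.
- exact: pb_act_smooth bE.
- exact: smooth_qdec_act.
- by move=> [a [h g]].
- move=> [a [h g]]; rewrite /= /qdec_tgt /cm_tgt /= ractM.
  rewrite (@mu_ractE a.1 _ g)// ractM; congr (raE (_, _)).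
  rewrite tauV cm_tau_alpha cm_tauM tauV !invgM !invgK tauV.
  by rewrite !mulgA mulgV mul1g.
- move=> [p g]; apply: qdec_eq => //=.
    by have e := congr1 (@gunit R X) (pb_fibre bE p g); exact (esym e).
  by rewrite invg1 mul1g (coh_f coh) (coh_e coh).
- move=> [b [h2 g2]] [a [h1 g1]] e e'; apply: qdec_eq; [exact: gcomp_eq|by []|].
  have eg : g2 = (tau cm h1 * g1)%g by case: e.
  have alg (v w : X2) x y : fp1 v = fp1 w -> fp2 v = fp2 w ->
      (alpha cm g1^-1 ((h2 * h1)^-1 * (x * y * (Hm v)^-1)) =
       alpha cm g2^-1 (h2^-1 * x) * alpha cm g1^-1 (h1^-1 * y) * (Hm w)^-1)%g.
    move=> v1 v2; rewrite (fp_eq v1 v2) mulgA cm_alphaM alpha_HmV; congr (_ * _)%g.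
    rewrite eg [((tau cm h1 * g1)^-1)%g]invgM cm_alpha_act -tauV cm_alpha_tau invgK.
    by rewrite -cm_alphaM [((h2 * h1)^-1)%g]invgM !mulgA mulgK.
  by refine (alg _ _ b.2 a.2 _ _).
Qed.

Lemma quasi_connection_qdec :
  quasi_connection (GG := cm_two_group cm) (EE := EE) (@qdec_proj R G H X E) raE
    (@qdec_act R G H X E cm) (@qdec_connection R G H X E).
Proof.
split=> //.
- move=> q; apply: (smooth_at_to_qdec); first exact: smooth_at_id.
  exact: smooth_at_cst.
- move=> gamma p g e e'; apply: qdec_eq => //=.
  by rewrite invg1 mul1g alpha_one.
Qed.

Lemma bproj_surj x : exists p : tot E, piE p = x.
Proof.
have [U [Phi [Psi [_ Ux [_ tM _]]]]] := pb_trivial bE x.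
by have [_ <- _] := tM x 1%g Ux; eexists.
Qed.

(** The unit at [p] is [(1, p, Hu p)], and the composite of two horizontal arrows
    over [(g2, g1)] has component [(Hm (g2, g1))^-1] in [H]. Since [bproj] is
    surjective, every composable pair of [X] lifts to horizontal arrows. *)
Lemma categorical_connection_qdec :
  categorical_connection (GG := cm_two_group cm) (EE := EE)
    (@qdec_proj R G H X E) raE (@qdec_act R G H X E cm)
    (@qdec_connection R G H X E) <->
  (forall p, Hu p = 1%g) /\ (forall u, Hm u = 1%g).
Proof.
split=> [C|[Hu1 Hm1]]; split.
- move=> p; have := cc_unit C (lg_src_unit lgX (piE p)) erefl.
  by move/(congr1 snd) => /= <-.
- move=> v; have [p pE] := bproj_surj (src (fp2 v)).
  pose q1 : Q := fpair (fp2 v) p (esym pE).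
  have e2 : src (fp1 v) = piE (qdec_tgt cm (qdec_connection q1 : D)).
    by rewrite proj_qdec_tgt fpE.
  have e : src (gcomp (fp1 v) (fp2 v) (fpE v)) = piE p by rewrite (lg_src_comp lgX).
  have := cc_comp C (gamma2 := fp1 v) (gamma1 := fp2 v) (e21 := fpE v)
    (e1 := esym pE) (e2 := e2) e erefl erefl.
  move/(congr1 snd) => /=; rewrite !mul1g => /esym/eqP.
  by rewrite invg_eq1 => /eqP <-; congr Hm; exact: fp_eq.
- exact: quasi_connection_qdec.
- by move=> x p e pE; subst x; apply: qdec_eq; rewrite //= Hu1.
- move=> g2 g1 p1 p2 e21 e1 e2 e ec p2E; apply: qdec_eq => //=.
    exact: gcomp_eq.
  by rewrite Hm1 invg1 !mul1g.
Qed.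

End Coherent.

End DecoratedGroupoid.

Theorem proposition3p9
    (R : realType) (G H : chartedGroupType R) (X : groupoid R)
    (E : quasi_principal_bundle G X) (cm : crossed_module G H)
    (Hu : tot E -> H) (Hm : fibprod (@src R X) (@tgt R X) -> H)
    (Hu_smooth : smooth Hu) (Hm_smooth : smooth Hm)
    (coh : coherent cm Hu Hm) :
  let EE := qdec_groupoid cm Hu Hm in
  let pi0 : obj EE -> obj X := @bproj R G X E in
  let pi1 : mor EE -> mor X := @qdec_proj R G H X E in
  let a0 : obj EE * tg_obj (cm_two_group cm) -> obj EE := @ract R G X E in
  let a1 : mor EE * tg_mor (cm_two_group cm) -> mor EE :=
    @qdec_act R G H X E cm in
  let C : fibprod (@src R X) pi0 -> mor EE := @qdec_connection R G H X E in
  [/\ lie_groupoid EE,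
      quasi_principal_two_bundle pi1 a0 a1 C &
      categorical_connection pi1 a0 a1 C <->
        (forall p, Hu p = 1%g) /\ (forall u, Hm u = 1%g)].
Proof.
move=> EE pi0 pi1 a0 a1 C.
have lgE : lie_groupoid EE by exact: lie_groupoid_qdec.
split; [exact: lgE| |exact: categorical_connection_qdec].
split; last exact: quasi_connection_qdec.
split.
- exact: lie_two_group_cm.
- exact: lgE.
- exact: qpb_base E.
- exact: lie_functor_qdec_proj.
- exact: lie_functor_qdec_act.
- exact: pb_action (qpb_principal E).
- exact: right_action_qdec.
- exact: qpb_principal E.
- exact: principal_bundle_qdec.
Qed.
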